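(* Let $p\in\mathbb{C}[t]$ be a non-constant polynomial with $e^{p(0)}=1$, and let $f(z)=\int_{0}^{z}e^{p(t)}\,dt$. Then $f$ belongs to $\mathrm{elh}(\mathbb{C})\setminus\mathrm{Aut}(\mathbb{C})$, and $f$ is prime if and only if $f(\mathbb{C})=\mathbb{C}$.
   Context: $\mathrm{elh}(\mathbb{C})$ is the set of all entire functions $f:\mathbb{C}\to\mathbb{C}$ with $f'(z)\neq 0$ for all $z\in\mathbb{C}$ and $f'(0)=1$. $\mathrm{Aut}(\mathbb{C})=\{z+a : a\in\mathbb{C}\}\subseteq\mathrm{elh}(\mathbb{C})$. A function $c\in\mathrm{elh}(\mathbb{C})$ is composite if there are entire functions $f,g$, neither of which is an affine map $z\mapsto \alpha z+\beta$ ($\alpha\in\mathbb{C}^\times$, $\beta\in\mathbb{C}$), such that $c=f\circ g$. The factors $f,g$ are not required to lie in $\mathrm{elh}(\mathbb{C})$. A function $p\in\mathrm{elh}(\mathbb{C})\setminus\mathrm{Aut}(\mathbb{C})$ is prime if it is not composite. *)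

(* Defs.v *)
From Stdlib Require Import Reals List.
From Coquelicot Require Import Coquelicot.

Open Scope C_scope.

(* With the instances fixed to [C_AbsRing] and [C_NormedModule], [ex_derive] is
   differentiability in the complex sense.  [C_derive f z] is then the complex
   derivative f'(z); it is meaningful only where [f] is differentiable. *)
Definition entire (f : C -> C) : Prop :=
  forall z : C, @ex_derive C_AbsRing C_NormedModule f z.

Definition elh (f : C -> C) : Prop :=
  entire f /\ (forall z : C, C_derive f z <> 0) /\ C_derive f 0 = 1.

Definition AutC (f : C -> C) : Prop :=
  exists a : C, forall z : C, f z = z + a.

Definition is_affine (f : C -> C) : Prop :=
  exists alpha beta : C, alpha <> 0 /\ forall z : C, f z = alpha * z + beta.

Definition composite (c : C -> C) : Prop :=
  elh c /\
  exists f g : C -> C,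
    entire f /\ entire g /\ ~ is_affine f /\ ~ is_affine g /\
    forall z : C, c z = f (g z).

Definition elh_prime (p : C -> C) : Prop :=
  elh p /\ ~ AutC p /\ ~ composite p.

(* exp (x + i y) = exp x * (cos y + i sin y) *)
Definition Cexp (z : C) : C :=
  RtoC (exp (Re z)) * (cos (Im z), sin (Im z)).

(* A polynomial over C is given by its list of coefficients, constant term
   first; trailing zeros are allowed, so the degree is not [length p - 1]. *)
Definition Cpoly_eval (p : list C) (t : C) : C :=
  fold_right (fun a r => a + t * r) (RtoC 0) p.

Definition Cpoly_nonconstant (p : list C) : Prop :=
  exists k : nat, (1 <= k)%nat /\ nth k p (RtoC 0) <> 0.

(* Integral of [g] along the segment from [a] to [b], parametrized by
   s |-> a + s (b - a) for s in [0, 1].  For entire [g] the integral does not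
   depend on the path, so this is the integral of [g] from [a] to [b]. *)
Definition C_int (g : C -> C) (a b : C) : C :=
  (b - a) *
  @RInt C_R_CompleteNormedModule (fun s : R => g (a + RtoC s * (b - a))) 0 1.

(* Main.v *)
Require Import Defs.
From Stdlib Require Import Reals List Lra Lia ZArith Classical ClassicalEpsilon.
From Coquelicot Require Import Coquelicot.

(* If f omits w, then f - w = e^h and f = (u^2 + w) o e^(h/2) is composite.

   Conversely let f = F o G be surjective with F, G entire and not affine. As
   f' = e^p, neither G' nor F' o G vanishes. Since f has finite order, a growth
   theorem for composites (the logarithm of G - u, for suitable u, is Lipschitz
   by Bloch's theorem) shows that G is at most of exponential-polynomial growth.
   If G omits a value w0, then G = w0 + e^h with h of polynomial growth
   (Borel-Caratheodory) and h' zero-free, so h is affine, f is periodic, p is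
   linear, and f = (e^p - e^p(0)) / p' omits a value. If G is onto, then
   F' = e^h, G' = e^q, and h o G = p - q + const has polynomial growth; either h
   is constant and F is affine, or the growth theorem makes G polynomially
   bounded, and then G', having no zeros, is constant. *)

Open Scope R_scope.
Open Scope C_scope.

(** * Complex derivatives *)

(** The obstacle is that nothing is known about the growth of [F], so a bound on [f] has to pass to
    [G] through a single point [a] with F'(a) nonzero. Cauchy's estimate at [a] yields u with |F(u)|
    > K at distance proportional to K, and the resulting bound on [G] is linear in K. A linear bound
    respects both growth classes, so one theorem serves twice: for f = F o G, and again for h o G,
    where F' = e^h. Surjectivity of [G] is what makes this h available, since the factorization
    alone shows F' to be zero-free only on the image of [G]. The Cauchy theory behind all this rests
    on one device: Fourier coefficients of a function on circles, evaluated by differentiating under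
    the integral sign in the radius or in the centre. *)

Lemma Cmod_sub_sym (x y : C) : Cmod (x - y) = Cmod (y - x).
Proof. rewrite <- Cmod_opp; f_equal; ring. Qed.

Lemma Cmod_triangle_sub (x y z : C) : Cmod (x - z) <= Cmod (x - y) + Cmod (y - z).
Proof. replace (x - z) with ((x - y) + (y - z)) by ring; apply Cmod_triangle. Qed.

Lemma Cmod_rtriangle (x y : C) : Cmod x - Cmod y <= Cmod (x - y).
Proof.
  assert (H := Cmod_triangle (x - y) y).
  replace (x - y + y) with x in H by ring; lra.
Qed.

Lemma Cmod_0_eq (x : C) : (forall e, 0 < e -> Cmod x <= e) -> x = 0.
Proof.
  intros H; apply Cmod_eq_0.
  destruct (Rle_lt_or_eq_dec _ _ (Cmod_ge_0 x)) as [h|h]; auto.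
  specialize (H (Cmod x / 2)%R); lra.
Qed.

Definition Ccont (f : C -> C) (z : C) : Prop :=
  forall e : R, 0 < e -> exists d : R, 0 < d /\
    forall w, Cmod (w - z) < d -> Cmod (f w - f z) < e.

Lemma Ccont_const (c z : C) : Ccont (fun _ => c) z.
Proof.
  intros e He; exists 1%R; split; [lra|intros w _].
  replace (c - c) with (RtoC 0) by ring; rewrite Cmod_0; lra.
Qed.

Lemma Ccont_id (z : C) : Ccont (fun w => w) z.
Proof. intros e He; exists e; auto. Qed.

Lemma Ccont_plus (f g : C -> C) (z : C) :
  Ccont f z -> Ccont g z -> Ccont (fun w => f w + g w) z.
Proof.
  intros Hf Hg e He.
  destruct (Hf (e / 2)%R) as [d1 [h1 H1]]; [lra|].
  destruct (Hg (e / 2)%R) as [d2 [h2 H2]]; [lra|].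
  exists (Rmin d1 d2); split; [now apply Rmin_pos|intros w Hw].
  assert (A := H1 w (Rlt_le_trans _ _ _ Hw (Rmin_l _ _))).
  assert (B := H2 w (Rlt_le_trans _ _ _ Hw (Rmin_r _ _))).
  replace (f w + g w - (f z + g z)) with ((f w - f z) + (g w - g z)) by ring.
  eapply Rle_lt_trans; [apply Cmod_triangle|lra].
Qed.

Lemma Ccont_bounded (f : C -> C) (z : C) :
  Ccont f z -> exists d, 0 < d /\ forall w, Cmod (w - z) < d -> Cmod (f w) <= Cmod (f z) + 1.
Proof.
  intros Hf; destruct (Hf 1%R) as [d [h H]]; [lra|].
  exists d; split; auto; intros w Hw; specialize (H w Hw).
  assert (A := Cmod_rtriangle (f w) (f z)); lra.
Qed.

Lemma Ccont_mult (f g : C -> C) (z : C) :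
  Ccont f z -> Ccont g z -> Ccont (fun w => f w * g w) z.
Proof.
  intros Hf Hg e He.
  destruct (Ccont_bounded f z Hf) as [d0 [h0 H0]].
  assert (P1 := Cmod_ge_0 (f z)); assert (P2 := Cmod_ge_0 (g z)).
  destruct (Hf (e / 2 / (Cmod (g z) + 1))%R) as [d1 [h1 H1]];
    [apply Rdiv_lt_0_compat; lra|].
  destruct (Hg (e / 2 / (Cmod (f z) + 1))%R) as [d2 [h2 H2]];
    [apply Rdiv_lt_0_compat; lra|].
  exists (Rmin d0 (Rmin d1 d2)); split; [repeat apply Rmin_pos; auto|intros w Hw].
  assert (A0 := H0 w (Rlt_le_trans _ _ _ Hw (Rmin_l _ _))).
  assert (Hw' := Rlt_le_trans _ _ _ Hw (Rmin_r _ _)).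
  assert (A := H1 w (Rlt_le_trans _ _ _ Hw' (Rmin_l _ _))).
  assert (B := H2 w (Rlt_le_trans _ _ _ Hw' (Rmin_r _ _))).
  replace (f w * g w - f z * g z) with (f w * (g w - g z) + (f w - f z) * g z) by ring.
  eapply Rle_lt_trans; [apply Cmod_triangle|]; rewrite !Cmod_mult.
  apply Rlt_div_r in A; [|lra]; apply Rlt_div_r in B; [|lra].
  assert (Q1 := Cmod_ge_0 (g w - g z)); assert (Q2 := Cmod_ge_0 (f w - f z)).
  nra.
Qed.

Lemma Ccont_comp (f g : C -> C) (z : C) :
  Ccont g z -> Ccont f (g z) -> Ccont (fun w => f (g w)) z.
Proof.
  intros Hg Hf e He; destruct (Hf e He) as [d [h H]].
  destruct (Hg d h) as [d' [h' H']]; exists d'; auto.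
Qed.

Lemma Ccont_neq0 (f : C -> C) (z : C) : Ccont f z -> f z <> 0 ->
  exists d, 0 < d /\ forall w, Cmod (w - z) < d -> Cmod (f z) / 2 <= Cmod (f w).
Proof.
  intros Hf Hz; apply Cmod_gt_0 in Hz.
  destruct (Hf (Cmod (f z) / 2)%R) as [d [h H]]; [lra|].
  exists d; split; auto; intros w Hw; specialize (H w Hw).
  rewrite Cmod_sub_sym in H; assert (A := Cmod_rtriangle (f z) (f w)); lra.
Qed.

Lemma Ccont_inv (f : C -> C) (z : C) :
  Ccont f z -> f z <> 0 -> Ccont (fun w => / f w) z.
Proof.
  intros Hf Hz e He.
  destruct (Ccont_neq0 f z Hf Hz) as [d0 [h0 H0]].
  assert (Pz := proj1 (Cmod_gt_0 _) Hz).
  assert (0 < Cmod (f z) * Cmod (f z)) by nra.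
  destruct (Hf (e * (Cmod (f z) * Cmod (f z) / 2))%R) as [d1 [h1 H1]]; [nra|].
  exists (Rmin d0 d1); split; [apply Rmin_pos; auto|intros w Hw].
  assert (A0 := H0 w (Rlt_le_trans _ _ _ Hw (Rmin_l _ _))).
  assert (A := H1 w (Rlt_le_trans _ _ _ Hw (Rmin_r _ _))).
  assert (Hw0 : f w <> 0) by (apply Cmod_gt_0; lra).
  replace (/ f w - / f z) with ((f z - f w) / (f w * f z)) by (field; auto).
  rewrite Cmod_div, Cmod_mult, Cmod_sub_sym by (now apply Cmult_neq_0).
  apply Rlt_div_l; [nra|].
  eapply Rlt_le_trans; [exact A|]; apply Rmult_le_compat_l; nra.
Qed.

(* Caratheodory's form of differentiability: the difference quotient extends
   continuously, so the rules of calculus reduce to those for continuity. *)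
Definition Cder (f : C -> C) (z l : C) : Prop :=
  exists phi : C -> C, Ccont phi z /\ phi z = l /\ forall w, f w = f z + phi w * (w - z).

Lemma Cder_cont f z l : Cder f z l -> Ccont f z.
Proof.
  intros [phi [H1 [H2 H3]]] e He.
  assert (K : Ccont (fun w => f z + phi w * (w + - z)) z).
  { repeat first [apply Ccont_plus|apply Ccont_mult|apply Ccont_const|apply Ccont_id|exact H1]. }
  destruct (K e He) as [d [h H]]; exists d; split; auto; intros w Hw.
  specialize (H w Hw); rewrite (H3 w).
  replace (f z + phi w * (w - z) - f z) with
    (f z + phi w * (w + - z) - (f z + phi z * (z + - z))) by ring; auto.
Qed.

Lemma Cder_const c z : Cder (fun _ => c) z 0.
Proof. exists (fun _ => RtoC 0); split; [apply Ccont_const|split; auto; intros; ring]. Qed.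

Lemma Cder_id z : Cder (fun w => w) z 1.
Proof. exists (fun _ => RtoC 1); split; [apply Ccont_const|split; auto; intros; ring]. Qed.

Lemma Cder_plus f g z l m : Cder f z l -> Cder g z m -> Cder (fun w => f w + g w) z (l + m).
Proof.
  intros [p [P1 [P2 P3]]] [q [Q1 [Q2 Q3]]].
  exists (fun w => p w + q w); split; [now apply Ccont_plus|split; [now rewrite P2, Q2|]].
  intros w; rewrite P3, Q3; ring.
Qed.

Lemma Cder_mult f g z l m :
  Cder f z l -> Cder g z m -> Cder (fun w => f w * g w) z (l * g z + f z * m).
Proof.
  intros Hf Hg; generalize (Cder_cont _ _ _ Hg); intros Hc.
  destruct Hf as [p [P1 [P2 P3]]]; destruct Hg as [q [Q1 [Q2 Q3]]].
  exists (fun w => p w * g w + f z * q w); split.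
  - repeat first [apply Ccont_plus|apply Ccont_mult|apply Ccont_const|assumption].
  - split; [now rewrite P2, Q2|]; intros w; rewrite P3, (Q3 w); ring.
Qed.

Lemma Cder_comp f g z l m :
  Cder g z m -> Cder f (g z) l -> Cder (fun w => f (g w)) z (l * m).
Proof.
  intros Hg Hf; generalize (Cder_cont _ _ _ Hg); intros Hc.
  destruct Hf as [p [P1 [P2 P3]]]; destruct Hg as [q [Q1 [Q2 Q3]]].
  exists (fun w => p (g w) * q w); split.
  - apply Ccont_mult; auto; now apply Ccont_comp.
  - split; [now rewrite P2, Q2|]; intros w; rewrite (P3 (g w)).
    assert (E : g w - g z = q w * (w - z)) by (rewrite (Q3 w); ring).
    rewrite E; ring.
Qed.

Lemma Cder_ext f g z l : (forall w, f w = g w) -> Cder f z l -> Cder g z l.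
Proof.
  intros E [p [P1 [P2 P3]]]; exists p; split; [|split]; auto.
  intros w; rewrite <- !E; auto.
Qed.

Lemma Cder_eq f z l m : Cder f z l -> l = m -> Cder f z m.
Proof. now intros H <-. Qed.

(** Caratheodory's form suits the algebraic rules; this one suits estimates, locality and
    differentiation under the integral sign. *)
Lemma Cder_eps f z l : Cder f z l <->
  forall e, 0 < e -> exists d, 0 < d /\
    forall w, Cmod (w - z) < d -> Cmod (f w - f z - l * (w - z)) <= e * Cmod (w - z).
Proof.
  split.
  - intros [p [P1 [P2 P3]]] e He; destruct (P1 e He) as [d [h H]].
    exists d; split; auto; intros w Hw; specialize (H w Hw).
    replace (f w - f z - l * (w - z)) with ((p w - p z) * (w - z))
      by (rewrite (P3 w), P2; ring).
    rewrite Cmod_mult; apply Rmult_le_compat_r; [apply Cmod_ge_0|lra].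
  - intros H.
    assert (D : forall w, {w = z} + {w <> z}) by (intros; apply excluded_middle_informative).
    exists (fun w => if D w then l else (f w - f z) / (w - z)); split; [|split].
    + intros e He; destruct (H (e / 2)%R) as [d [h H']]; [lra|].
      exists d; split; auto; intros w Hw; specialize (H' w Hw).
      destruct (D z) as [_|n]; [|now elim n].
      destruct (D w) as [_|n].
      * replace (l - l) with (RtoC 0) by ring; rewrite Cmod_0; auto.
      * assert (N : w - z <> 0) by now apply Cminus_eq_contra.
        replace ((f w - f z) / (w - z) - l) with ((f w - f z - l * (w - z)) / (w - z))
          by (field; auto).
        rewrite Cmod_div by auto; apply Cmod_gt_0 in N; apply Rlt_div_l; nra.
    + destruct (D z) as [_|n]; [auto|now elim n].
    + intros w; destruct (D w) as [->|n]; [ring|].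
      field; now apply Cminus_eq_contra.
Qed.

(** The identity in [Cder] must hold for all [w]; locality becomes visible only in the form
    [Cder_eps]. *)
Lemma Cder_local f g z l d : 0 < d -> (forall w, Cmod (w - z) < d -> f w = g w) ->
  Cder f z l -> Cder g z l.
Proof.
  intros Hd E; rewrite !Cder_eps; intros H e He; destruct (H e He) as [d' [h' H']].
  exists (Rmin d d'); split; [now apply Rmin_pos|]; intros w Hw.
  rewrite <- !E; [apply H'| |].
  - eapply Rlt_le_trans; [apply Hw|apply Rmin_r].
  - replace (z - z) with (RtoC 0) by ring; rewrite Cmod_0; auto.
  - eapply Rlt_le_trans; [apply Hw|apply Rmin_l].
Qed.

Lemma Cder_inv f z l : Cder f z l -> f z <> 0 -> Cder (fun w => / f w) z (- l / (f z * f z)).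
Proof.
  intros Hf Hz; assert (Hc := Cder_cont _ _ _ Hf).
  destruct (Ccont_neq0 f z Hc Hz) as [d [h H]].
  destruct Hf as [p [P1 [P2 P3]]].
  assert (Pz := proj1 (Cmod_gt_0 _) Hz).
  (* This function equals 1/f near z, where f has no zero, and satisfies Caratheodory's identity for
     every [w]. *)
  apply (Cder_local (fun w => / f z + (- p w / (f w * f z)) * (w - z)) _ _ _ d h).
  - intros w Hw; assert (f w <> 0) by (apply Cmod_gt_0; specialize (H w Hw); lra).
    replace (w - z) with ((w - z) * 1) by ring.
    assert (E : - p w * (w - z) = f z - f w) by (rewrite (P3 w); ring).
    transitivity (/ f z + (- p w * (w - z)) / (f w * f z)); [field; auto|].
    rewrite E; field; auto.
  - exists (fun w => - p w / (f w * f z)); split; [|split].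
    + apply (Ccont_mult (fun w => - p w) (fun w => / (f w * f z))).
      * apply (Ccont_comp Copp); auto; intros e He; exists e; split; auto.
        intros w Hw; replace (- w - - p z) with (- (w - p z)) by ring; now rewrite Cmod_opp.
      * apply (Ccont_inv (fun w => f w * f z)); [|now apply Cmult_neq_0].
        apply Ccont_mult; auto; apply Ccont_const.
    + now rewrite P2.
    + intros w; ring.
Qed.

Lemma Cder_unique f z l m : Cder f z l -> Cder f z m -> l = m.
Proof.
  rewrite !Cder_eps; intros H1 H2.
  assert (E : l - m = 0).
  { apply Cmod_0_eq; intros e He.
    destruct (H1 (e / 2)%R) as [d1 [h1 K1]]; [lra|].
    destruct (H2 (e / 2)%R) as [d2 [h2 K2]]; [lra|].
    set (d := (Rmin d1 d2 / 2)%R).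
    assert (Hd : 0 < d) by (unfold d; assert (0 < Rmin d1 d2) by (now apply Rmin_pos); lra).
    assert (A1 := Rmin_l d1 d2); assert (A2 := Rmin_r d1 d2).
    assert (Ed : Cmod (z + RtoC d - z) = d).
    { replace (z + RtoC d - z) with (RtoC d) by ring.
      rewrite Cmod_R, Rabs_pos_eq; lra. }
    specialize (K1 (z + RtoC d)); specialize (K2 (z + RtoC d)).
    rewrite Ed in K1, K2.
    assert (B1 := K1 ltac:(unfold d in *; lra)); assert (B2 := K2 ltac:(unfold d in *; lra)).
    set (u := f (z + RtoC d) - f z) in *.
    replace (z + RtoC d - z) with (RtoC d) in B1, B2 by ring.
    assert (C1 : Cmod ((l - m) * RtoC d) <= e * d).
    { replace ((l - m) * RtoC d) with ((u - m * RtoC d) - (u - l * RtoC d)) by ring.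
      unfold Cminus at 1; eapply Rle_trans; [apply Cmod_triangle|].
      rewrite Cmod_opp; lra. }
    rewrite Cmod_mult, Cmod_R, Rabs_pos_eq in C1 by lra.
    apply Rmult_le_reg_r in C1; auto. }
  replace l with (l - m + m) by ring; rewrite E; ring.
Qed.

Lemma Cder_minus f g z l m : Cder f z l -> Cder g z m -> Cder (fun w => f w - g w) z (l - m).
Proof.
  intros Hf Hg.
  apply (Cder_ext (fun w => f w + (- (1)) * g w)); [intros; ring|].
  eapply Cder_eq; [apply Cder_plus; [exact Hf|apply Cder_mult; [apply Cder_const|exact Hg]]|].
  cbv beta; ring.
Qed.

Lemma Cder_scal c f z l : Cder f z l -> Cder (fun w => c * f w) z (c * l).
Proof.
  intros Hf; eapply Cder_eq; [apply Cder_mult; [apply Cder_const|exact Hf]|]; cbv beta; ring.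
Qed.

Lemma Cder_div f g z l m : Cder f z l -> Cder g z m -> g z <> 0 ->
  Cder (fun w => f w / g w) z ((l * g z - f z * m) / (g z * g z)).
Proof.
  intros Hf Hg Hz; eapply Cder_eq; [apply Cder_mult; [exact Hf|apply Cder_inv; eauto]|].
  cbv beta; field; auto.
Qed.

Lemma is_derive_Cder (f : C -> C) (z l : C) :
  @is_derive C_AbsRing C_NormedModule f z l <-> Cder f z l.
Proof.
  rewrite Cder_eps; split.
  - intros [_ H] e He.
    specialize (H z (fun P HP => HP) (mkposreal e He)).
    destruct H as [d H]; exists (d : R); split; [apply cond_pos|]; intros w Hw.
    specialize (H w Hw).
    eapply Rle_trans; [|exact H]; apply Req_le.
    change (Cmod (f w - f z - l * (w - z)) = Cmod (f w - f z - (w - z) * l)).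
    f_equal; ring.
  - intros H; split; [apply is_linear_scal_l|].
    intros x Hx e; apply (@is_filter_lim_locally_unique C_AbsRing (AbsRing_NormedModule C_AbsRing)) in Hx; subst x.
    destruct (H e (cond_pos e)) as [d [h H']]; exists (mkposreal d h); intros w Hw.
    specialize (H' w Hw); eapply Rle_trans; [|exact H']; apply Req_le.
    change (Cmod (f w - f z - (w - z) * l) = Cmod (f w - f z - l * (w - z))).
    f_equal; ring.
Qed.

Lemma entire_Cder f : entire f <-> forall z, exists l, Cder f z l.
Proof.
  split; intros H z; destruct (H z) as [l Hl]; exists l; now apply is_derive_Cder.
Qed.

Lemma C_derive_Cder f z l : Cder f z l -> C_derive f z = l.
Proof. intros H; now apply is_C_derive_unique, is_derive_Cder. Qed.

(** * The complex exponential *)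

Lemma Cexp_plus (z w : C) : Cexp (z + w) = Cexp z * Cexp w.
Proof.
  unfold Cexp; destruct z as [a b], w as [c d]; simpl.
  rewrite exp_plus, cos_plus, sin_plus.
  unfold RtoC, Cmult; simpl; f_equal; ring.
Qed.

Lemma Cexp_0 : Cexp 0 = 1.
Proof.
  unfold Cexp; simpl; rewrite exp_0, cos_0, sin_0.
  unfold RtoC, Cmult; simpl; f_equal; ring.
Qed.

Lemma Cmod_Cexp (z : C) : Cmod (Cexp z) = exp (Re z).
Proof.
  unfold Cexp; rewrite Cmod_mult, Cmod_R, Rabs_pos_eq by (left; apply exp_pos).
  replace (Cmod (cos (Im z), sin (Im z))) with 1%R; [ring|].
  unfold Cmod; simpl; symmetry.
  replace (cos (Im z) * (cos (Im z) * 1) + sin (Im z) * (sin (Im z) * 1))%R with 1%R.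
  - apply sqrt_1.
  - generalize (sin2_cos2 (Im z)); unfold Rsqr; lra.
Qed.

Lemma Cexp_neq_0 (z : C) : Cexp z <> 0.
Proof. apply Cmod_gt_0; rewrite Cmod_Cexp; apply exp_pos. Qed.

Lemma Cmod_le_abs (x y : R) : Cmod (x, y) <= Rabs x + Rabs y.
Proof.
  replace (x, y) with (RtoC x + Ci * RtoC y)
    by (unfold Ci, RtoC, Cmult, Cplus; simpl; f_equal; ring).
  eapply Rle_trans; [apply Cmod_triangle|].
  rewrite Cmod_mult, Cmod_Ci, !Cmod_R; lra.
Qed.

Lemma im_le_Cmod (c : C) : Rabs (Im c) <= Cmod c.
Proof. eapply Rle_trans; [apply Rmax_r|apply Rmax_Cmod]. Qed.

Lemma derivable_pt_lim_0_eps (f : R -> R) (l : R) : derivable_pt_lim f 0 l ->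
  forall e, 0 < e -> exists d, 0 < d /\
    forall x, Rabs x < d -> Rabs (f x - f 0 - l * x) <= e * Rabs x.
Proof.
  intros H e He; destruct (H e He) as [d Hd]; exists (d : R); split; [apply cond_pos|].
  intros x Hx; destruct (Req_dec x 0) as [->|n].
  - replace (f 0 - f 0 - l * 0)%R with 0%R by ring; rewrite Rabs_R0; lra.
  - specialize (Hd x n Hx); rewrite Rplus_0_l in Hd.
    replace (f x - f 0 - l * x)%R with (((f x - f 0) / x - l) * x)%R by (field; auto).
    rewrite Rabs_mult; apply Rmult_le_compat_r; [apply Rabs_pos|lra].
Qed.

(** The derivative at 0 comes from those of the real exp, cos and sin at 0; the functional equation
    carries it to z. *)
Lemma Cder_Cexp (z : C) : Cder Cexp z (Cexp z).
Proof.
  assert (D0 : Cder Cexp 0 1).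
  { apply Cder_eps; intros e He.
    (* The three error terms below add up to at most 6 e' |w|. The bound 1 gives |exp x - 1| <= 2
       |x|, which is at most e' for |x| < e'/2. *)
    set (e' := Rmin 1 (e / 8)).
    assert (He' : 0 < e') by (apply Rmin_pos; lra).
    assert (E1 : e' <= 1) by apply Rmin_l.
    assert (E2 : e' <= e / 8) by apply Rmin_r.
    destruct (derivable_pt_lim_0_eps _ _ (derivable_pt_lim_exp 0) e' He') as [d1 [h1 H1]].
    destruct (derivable_pt_lim_0_eps _ _ (derivable_pt_lim_cos 0) e' He') as [d2 [h2 H2]].
    destruct (derivable_pt_lim_0_eps _ _ (derivable_pt_lim_sin 0) e' He') as [d3 [h3 H3]].
    exists (Rmin (e' / 2) (Rmin d1 (Rmin d2 d3))).
    split; [repeat apply Rmin_pos; lra|intros w Hw].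
    replace (w - 0) with w in * by ring.
    assert (Hm : Cmod w < e' / 2 /\ Cmod w < d1 /\ Cmod w < d2 /\ Cmod w < d3).
    { repeat split; eapply Rlt_le_trans; try exact Hw;
        unfold Rmin; repeat destruct Rle_dec; lra. }
    assert (Hx := re_le_Cmod w); assert (Hy := im_le_Cmod w).
    rewrite Cexp_0; destruct w as [x y]; simpl in Hx, Hy.
    specialize (H1 x ltac:(lra)); specialize (H2 y ltac:(lra)); specialize (H3 y ltac:(lra)).
    rewrite exp_0 in H1; rewrite cos_0, sin_0 in H2; rewrite sin_0, cos_0 in H3.
    replace (exp x - 1 - 1 * x)%R with (exp x - 1 - x)%R in H1 by ring.
    replace (cos y - 1 - - 0 * y)%R with (cos y - 1)%R in H2 by ring.
    replace (sin y - 0 - 1 * y)%R with (sin y - y)%R in H3 by ring.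
    assert (Px := Rabs_pos x); assert (Py := Rabs_pos y).
    assert (X1 : Rabs (exp x - 1) <= e').
    { replace (exp x - 1)%R with ((exp x - 1 - x) + x)%R by ring.
      eapply Rle_trans; [apply Rabs_triang|]; nra. }
    assert (X2 : 0 < exp x <= 2).
    { split; [apply exp_pos|]; apply Rabs_le_between in X1; lra. }
    replace (Cexp (x, y) - 1 - 1 * (x, y)) with
      (RtoC (exp x - 1 - x) + RtoC (exp x) * (cos y - 1, sin y - y)%R
       + Ci * RtoC (y * (exp x - 1))).
    2:{ apply injective_projections; simpl; ring. }
    eapply Rle_trans; [apply Cmod_triangle|].
    eapply Rle_trans; [apply Rplus_le_compat_r, Cmod_triangle|].
    rewrite !Cmod_mult, Cmod_Ci, !Cmod_R, Rabs_mult, (Rabs_pos_eq (exp x)) by lra.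
    assert (Y := Cmod_le_abs (cos y - 1) (sin y - y)).
    assert (Y0 := Cmod_ge_0 (cos y - 1, sin y - y)%R).
    assert (exp x * Cmod (cos y - 1, sin y - y)%R <= 2 * (2 * (e' * Rabs y))) by nra.
    assert (Rabs y * Rabs (exp x - 1) <= e' * Rabs y) by nra.
    assert (e' * Rabs y <= e' * Cmod (x, y)) by nra.
    assert (e' * Rabs x <= e' * Cmod (x, y)) by nra.
    assert (e' * Cmod (x, y) <= e / 8 * Cmod (x, y)) by (apply Rmult_le_compat_r; [apply Cmod_ge_0|lra]).
    lra. }
  apply (Cder_ext (fun w => Cexp z * Cexp (w - z))).
  { intros w; rewrite <- Cexp_plus; f_equal; ring. }
  eapply Cder_eq; [apply Cder_scal, (Cder_comp Cexp (fun w => w - z))|].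
  - apply Cder_minus; [apply Cder_id|apply Cder_const].
  - replace (z - z) with (RtoC 0) by ring; exact D0.
  - ring.
Qed.

Lemma Cexp_opp (z : C) : Cexp (- z) = / Cexp z.
Proof.
  assert (H : Cexp (- z) * Cexp z = 1) by (rewrite <- Cexp_plus, <- Cexp_0; f_equal; ring).
  assert (N := Cexp_neq_0 z).
  transitivity (Cexp (- z) * Cexp z / Cexp z); [field; auto|rewrite H; field; auto].
Qed.

Lemma Cexp_surj (w : C) : w <> 0 -> exists z, Cexp z = w.
Proof.
  intros Hw; apply Cmod_gt_0 in Hw.
  assert (E : (Cmod w ^ 2 = Re w ^ 2 + Im w ^ 2)%R) by apply Cmod2_alt.
  set (r := Cmod w) in *.
  set (x := (Re w / r)%R); set (y := (Im w / r)%R).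
  assert (U : (x * x + y * y = 1)%R).
  { unfold x, y; replace (Re w / r * (Re w / r) + Im w / r * (Im w / r))%R
      with ((Re w ^ 2 + Im w ^ 2) / (r ^ 2))%R by (field; lra).
    rewrite <- E; field; lra. }
  assert (Bx : -1 <= x <= 1) by nra.
  (* The angle is acos x up to sign, and the sign is that of y. *)
  assert (S : exists t, cos t = x /\ sin t = y).
  { assert (C1 := cos_acos x Bx); assert (S1 := sin_acos x Bx).
    assert (Q : sqrt (1 - x²) = Rabs y).
    { rewrite <- sqrt_Rsqr_abs; f_equal; unfold Rsqr; lra. }
    destruct (Rle_dec 0 y) as [P|P].
    - exists (acos x); rewrite C1, S1, Q, Rabs_pos_eq; auto.
    - exists (- acos x)%R; rewrite cos_neg, sin_neg, C1, S1, Q, Rabs_left by lra.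
      split; [auto|ring]. }
  destruct S as [t [St1 St2]].
  exists (ln r, t); unfold Cexp; simpl; rewrite exp_ln, St1, St2 by auto.
  destruct w as [a b]; unfold x, y, RtoC, Cmult; simpl; f_equal; field; lra.
Qed.

Lemma Cexp_2PI (z : C) : Cexp (z + Ci * RtoC (2 * PI)) = Cexp z.
Proof.
  rewrite Cexp_plus; replace (Cexp (Ci * RtoC (2 * PI))) with (RtoC 1); [ring|].
  unfold Cexp, Ci, RtoC, Cmult; simpl.
  replace (0 * (2 * PI) - 1 * 0)%R with 0%R by ring.
  replace (0 * 0 + 1 * (2 * PI))%R with (2 * PI)%R by ring.
  rewrite exp_0, cos_2PI, sin_2PI; f_equal; ring.
Qed.

Lemma ball_Cmod (x y : C) (e : R) : Cmod (y - x) < e -> @ball C_UniformSpace x e y.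
Proof. apply C_NormedModule_mixin_compat1. Qed.

Lemma continuous_restr (f : C -> C) (t : R) : Ccont f (RtoC t) ->
  @continuous R_UniformSpace C_UniformSpace (fun s : R => f (RtoC s)) t.
Proof.
  intros H P [e He]; destruct (H e (cond_pos e)) as [d [h Hd]].
  exists (mkposreal d h); intros s Hs; apply He, ball_Cmod, Hd.
  rewrite <- RtoC_minus, Cmod_R; exact Hs.
Qed.

Lemma norm_C_R (u : C) : @norm R_AbsRing C_R_NormedModule u = Cmod u.
Proof.
  unfold norm; simpl; unfold prod_norm, Cmod; simpl.
  unfold norm; simpl; unfold abs; simpl.
  f_equal; rewrite !Rmult_1_r, <- !Rabs_mult, !Rabs_pos_eq; auto; nra.
Qed.

Lemma is_derive_restr (f : C -> C) (t : R) (l : C) : Cder f (RtoC t) l ->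
  @is_derive R_AbsRing C_R_NormedModule (fun s : R => f (RtoC s)) t l.
Proof.
  rewrite Cder_eps; intros H; split; [apply is_linear_scal_l|].
  intros x Hx e; apply (@is_filter_lim_locally_unique R_AbsRing (AbsRing_NormedModule R_AbsRing)) in Hx; subst x.
  destruct (H e (cond_pos e)) as [d [h H']]; exists (mkposreal d h); intros s Hs.
  specialize (H' (RtoC s)); rewrite <- RtoC_minus, !Cmod_R in H'; specialize (H' Hs).
  eapply Rle_trans; [|exact H'].
  change (@norm R_AbsRing C_R_NormedModule
    (f (RtoC s) - f (RtoC t) - @scal R_AbsRing C_R_NormedModule (s - t)%R l) <= Cmod (f (RtoC s) - f (RtoC t) - l * RtoC (s - t))).
  rewrite norm_C_R; apply Req_le; f_equal; f_equal; f_equal.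
  unfold scal; simpl; unfold prod_scal; destruct l; unfold scal; simpl.
  unfold mult, RtoC, Cmult; simpl; f_equal; ring.
Qed.

(** * Integration along segments *)

(* Integrands over a real interval are restrictions of functions of a complex
   variable, so that only complex derivatives are ever needed. *)
Definition CI (g : C -> C) (a b : R) : C :=
  @RInt C_R_CompleteNormedModule (fun t : R => g (RtoC t)) a b.

Definition contI (g : C -> C) (a b : R) : Prop :=
  forall t : R, a <= t <= b -> Ccont g (RtoC t).

Lemma ex_CI g a b : a <= b -> contI g a b ->
  @ex_RInt C_R_CompleteNormedModule (fun t : R => g (RtoC t)) a b.
Proof.
  intros Hab Hg; apply (@ex_RInt_continuous C_R_CompleteNormedModule).
  rewrite Rmin_left, Rmax_right by auto; intros t Ht; now apply continuous_restr, Hg.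
Qed.

Lemma is_CI g a b : a <= b -> contI g a b ->
  @is_RInt C_R_NormedModule (fun t : R => g (RtoC t)) a b (CI g a b).
Proof. intros; apply (@RInt_correct C_R_CompleteNormedModule); now apply ex_CI. Qed.

Lemma CI_unique (g : C -> C) a b l :
  @is_RInt C_R_NormedModule (fun t : R => g (RtoC t)) a b l -> CI g a b = l.
Proof. apply (@is_RInt_unique C_R_CompleteNormedModule). Qed.

Lemma CI_ext g h a b : a <= b ->
  (forall t : R, a <= t <= b -> g (RtoC t) = h (RtoC t)) -> CI g a b = CI h a b.
Proof.
  intros Hab E; apply (@RInt_ext C_R_CompleteNormedModule).
  rewrite Rmin_left, Rmax_right by auto; intros t Ht; apply E; lra.
Qed.

(** [C_R_NormedModule] has real scalars, so a complex factor is treated through its two real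
    components. *)
Lemma CI_scal c g a b : a <= b -> contI g a b ->
  CI (fun t => c * g t) a b = c * CI g a b.
Proof.
  intros Hab Hg; apply CI_unique; assert (H := is_CI g a b Hab Hg).
  destruct (CI g a b) as [l1 l2]; destruct c as [c1 c2].
  assert (F := is_RInt_fct_extend_fst _ _ _ _ H); assert (S := is_RInt_fct_extend_snd _ _ _ _ H).
  simpl in F, S.
  apply (@is_RInt_fct_extend_pair R_NormedModule R_NormedModule); simpl.
  - apply (@is_RInt_minus R_NormedModule); now apply (@is_RInt_scal R_NormedModule).
  - apply (@is_RInt_plus R_NormedModule); now apply (@is_RInt_scal R_NormedModule).
Qed.

Lemma CI_minus g h a b : a <= b -> contI g a b -> contI h a b ->
  CI (fun t => g t - h t) a b = CI g a b - CI h a b.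
Proof.
  intros Hab Hg Hh; apply CI_unique.
  now apply (@is_RInt_minus C_R_NormedModule); apply is_CI.
Qed.

Lemma CI_bound g a b M : a <= b -> contI g a b ->
  (forall t : R, a <= t <= b -> Cmod (g (RtoC t)) <= M) -> Cmod (CI g a b) <= (b - a) * M.
Proof.
  intros Hab Hg HM; rewrite <- norm_C_R.
  apply (@norm_RInt_le_const C_R_NormedModule (fun t => g (RtoC t))); auto.
  - intros t Ht; rewrite norm_C_R; now apply HM.
  - now apply is_CI.
Qed.

Lemma CI_FTC F g a b : a <= b -> contI g a b ->
  (forall t : R, a <= t <= b -> Cder F (RtoC t) (g (RtoC t))) ->
  CI g a b = F (RtoC b) - F (RtoC a).
Proof.
  intros Hab Hg HF; apply CI_unique.
  apply (@is_RInt_derive C_R_CompleteNormedModule (fun t => F (RtoC t)));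
    rewrite Rmin_left, Rmax_right by auto; intros t Ht.
  - now apply is_derive_restr, HF.
  - now apply continuous_restr, Hg.
Qed.

Lemma CI_const c a b : a <= b -> CI (fun _ => c) a b = RtoC (b - a) * c.
Proof.
  intros Hab; rewrite (CI_FTC (fun t => t * c)); auto.
  - rewrite RtoC_minus; ring.
  - intros t _; apply Ccont_const.
  - intros t _; eapply Cder_eq; [apply Cder_mult; [apply Cder_id|apply Cder_const]|]; cbv beta; ring.
Qed.

Lemma scal_C_R (r : R) (z : C) : @scal R_AbsRing C_R_NormedModule r z = RtoC r * z.
Proof.
  destruct z; unfold scal; simpl; unfold prod_scal, scal; simpl; unfold mult; simpl.
  apply injective_projections; simpl; ring.
Qed.

Definition convex (U : C -> Prop) : Prop :=
  forall (a b : C) (t : R), U a -> U b -> 0 <= t <= 1 -> U (a + RtoC t * (b - a)).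

Definition openC (U : C -> Prop) : Prop :=
  forall z, U z -> exists d, 0 < d /\ forall w, Cmod (w - z) < d -> U w.

Lemma Cder_line (a b : C) z : Cder (fun t => a + t * b) z b.
Proof.
  eapply Cder_eq; [apply Cder_plus; [apply Cder_const|
    apply Cder_mult; [apply Cder_id|apply Cder_const]]|]; cbv beta; ring.
Qed.

Lemma seg_cont U f a b : convex U -> (forall z, U z -> Ccont f z) -> U a -> U b ->
  contI (fun s => f (a + s * (b - a))) 0 1.
Proof.
  intros HU Hf Ha Hb t Ht; apply (Ccont_comp f (fun s => a + s * (b - a))).
  - eapply Cder_cont, Cder_line.
  - now apply Hf, HU.
Qed.

Lemma C_int_CI f a b : C_int f a b = (b - a) * CI (fun s => f (a + s * (b - a))) 0 1.
Proof. reflexivity. Qed.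

Lemma seg_opp U f a b : convex U -> (forall z, U z -> Ccont f z) -> U a -> U b ->
  C_int f b a = - C_int f a b.
Proof.
  intros HU Hf Ha Hb; rewrite !C_int_CI.
  assert (E : CI (fun s => f (b + s * (a - b))) 0 1 = CI (fun s => f (a + s * (b - a))) 0 1).
  2:{ rewrite E; ring. }
  symmetry; apply CI_unique.
  assert (H := is_CI _ 0 1 Rle_0_1 (seg_cont U f b a HU Hf Hb Ha)).
  apply is_RInt_swap in H.
  (* The end points are written as images of 0 and 1 under s -> 1 - s, the shape that
     [is_RInt_comp_lin] expects. *)
  replace 1%R with (-1 * 0 + 1)%R in H at 1 by ring.
  replace 0%R with (-1 * 1 + 1)%R in H at 2 by ring.
  apply (@is_RInt_comp_lin C_R_NormedModule) in H.
  apply (@is_RInt_scal C_R_NormedModule _ _ _ (-1)%R) in H.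
  rewrite scal_C_R in H; replace (CI (fun s => f (b + s * (a - b))) 0 1) with
    (RtoC (-1) * @opp C_R_NormedModule (CI (fun s => f (b + s * (a - b))) 0 1)).
  2:{ apply injective_projections; simpl; unfold opp; simpl; ring. }
  eapply is_RInt_ext; [|exact H]; intros t _; simpl.
  rewrite !scal_C_R, RtoC_plus, RtoC_mult.
  replace (b + (RtoC (-1) * RtoC t + 1) * (a - b)) with (a + RtoC t * (b - a)) by ring.
  ring.
Qed.

Lemma seg_split U f a b : convex U -> (forall z, U z -> Ccont f z) -> U a -> U b ->
  C_int f a b = C_int f a ((a + b) / 2) + C_int f ((a + b) / 2) b.
Proof.
  intros HU Hf Ha Hb; rewrite !C_int_CI.
  set (m := (a + b) / 2); set (g := fun s => f (a + s * (b - a))).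
  assert (Hg := seg_cont U f a b HU Hf Ha Hb); fold g in Hg.
  assert (E2 : RtoC 2 <> 0) by (intros K; apply RtoC_inj in K; lra).
  assert (G1 : contI g 0 (1/2)) by (intros t Ht; apply Hg; lra).
  assert (G2 : contI g (1/2) 1) by (intros t Ht; apply Hg; lra).
  assert (I1 := is_CI g 0 (1/2) ltac:(lra) G1); assert (I2 := is_CI g (1/2) 1 ltac:(lra) G2).
  assert (E : CI g 0 1 = CI g 0 (1/2) + CI g (1/2) 1).
  { apply CI_unique; now apply (@is_RInt_Chasles C_R_NormedModule _ _ (1/2)%R). }
  (* Each half is reparametrized over [0, 1] by t/2 or t/2 + 1/2; the factor 1/2 so produced is
     undone by scaling with 2. *)
  replace 0%R with (1/2 * 0 + 0)%R in I1 at 1 by ring.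
  replace (1/2)%R with (1/2 * 1 + 0)%R in I1 at 2 by field.
  replace (1/2)%R with (1/2 * 0 + 1/2)%R in I2 at 1 by field.
  replace 1%R with (1/2 * 1 + 1/2)%R in I2 at 3 by field.
  apply (@is_RInt_comp_lin C_R_NormedModule) in I1.
  apply (@is_RInt_comp_lin C_R_NormedModule) in I2.
  apply (@is_RInt_scal C_R_NormedModule _ _ _ 2%R) in I1.
  apply (@is_RInt_scal C_R_NormedModule _ _ _ 2%R) in I2.
  rewrite scal_C_R in I1, I2.
  rewrite (CI_unique (fun s => f (a + s * (m - a))) 0 1 (RtoC 2 * CI g 0 (1 / 2))).
  2:{ eapply is_RInt_ext; [|exact I1]; intros t _; simpl; unfold g.
    rewrite !scal_C_R, RtoC_plus, RtoC_mult, RtoC_div by lra; unfold m.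
    replace (a + ((RtoC 1 / RtoC 2) * RtoC t + 0) * (b - a)) with (a + RtoC t * ((a + b) / 2 - a))
      by (field; auto); field; auto. }
  rewrite (CI_unique (fun s => f (m + s * (b - m))) 0 1 (RtoC 2 * CI g (1 / 2) 1)).
  2:{ eapply is_RInt_ext; [|exact I2]; intros t _; simpl; unfold g.
    rewrite !scal_C_R, RtoC_plus, RtoC_mult, RtoC_div by lra; unfold m.
    replace (a + ((RtoC 1 / RtoC 2) * RtoC t + RtoC 1 / RtoC 2) * (b - a)) with
      ((a + b) / 2 + RtoC t * (b - (a + b) / 2))
      by (field; auto); field; auto. }
  rewrite E; unfold m; field; auto.
Qed.

Lemma seg_bound U f a b M : convex U -> (forall z, U z -> Ccont f z) -> U a -> U b ->
  (forall t : R, 0 <= t <= 1 -> Cmod (f (a + RtoC t * (b - a))) <= M) ->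
  Cmod (C_int f a b) <= M * Cmod (b - a).
Proof.
  intros HU Hf Ha Hb HM; rewrite C_int_CI, Cmod_mult, Rmult_comm.
  apply Rmult_le_compat_r; [apply Cmod_ge_0|].
  replace M with ((1 - 0) * M)%R by ring.
  apply CI_bound; [lra|now apply (seg_cont U)|auto].
Qed.

Lemma seg_FTC U F f a b : convex U -> (forall z, U z -> Ccont f z) -> U a -> U b ->
  (forall z, U z -> Cder F z (f z)) -> C_int f a b = F b - F a.
Proof.
  intros HU Hf Ha Hb HF; rewrite C_int_CI, <- CI_scal; [|lra|now apply (seg_cont U)].
  rewrite (CI_FTC (fun t => F (a + t * (b - a)))); [| lra | |].
  - f_equal; f_equal; ring.
  - intros t Ht; apply (Ccont_mult (fun _ => b - a)); [apply Ccont_const|].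
    now apply (seg_cont U f).
  - intros t Ht; eapply Cder_eq; [apply (Cder_comp F); [apply Cder_line|apply HF, HU; auto]|].
    ring.
Qed.

Lemma seg_minus U f g a b : convex U -> (forall z, U z -> Ccont f z) ->
  (forall z, U z -> Ccont g z) -> U a -> U b ->
  C_int (fun z => f z - g z) a b = C_int f a b - C_int g a b.
Proof.
  intros HU Hf Hg Ha Hb; rewrite !C_int_CI.
  rewrite (CI_minus (fun s => f (a + s * (b - a))) (fun s => g (a + s * (b - a))));
    [ring|lra| |]; now apply (seg_cont U).
Qed.

(** * Goursat's theorem and primitives *)

Definition closedC (K : C -> Prop) : Prop :=
  forall z, (forall e, 0 < e -> exists w, K w /\ Cmod (w - z) < e) -> K z.

Definition tri (f : C -> C) (T : C * C * C) : C :=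
  let '(a, b, c) := T in C_int f a b + C_int f b c + C_int f c a.

Definition perimeter (T : C * C * C) : R :=
  let '(a, b, c) := T in (Cmod (b - a) + Cmod (c - b) + Cmod (a - c))%R.

Definition vertices_in (K : C -> Prop) (T : C * C * C) : Prop :=
  let '(a, b, c) := T in K a /\ K b /\ K c.

(** The middle triangle is oriented so that each of its sides reverses the inner side of a corner
    triangle; in [tri_subtriangles] these sides cancel. *)
Definition subtriangles (T : C * C * C) : list (C * C * C) :=
  let '(a, b, c) := T in
  let mc := (a + b) / 2 in let ma := (b + c) / 2 in let mb := (c + a) / 2 in
  (a, mc, mb) :: (mc, b, ma) :: (mb, ma, c) :: (ma, mb, mc) :: nil.

Lemma C2_neq_0 : RtoC 2 <> 0.
Proof. intros K; apply RtoC_inj in K; lra. Qed.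

Lemma convex_mid K a b : convex K -> K a -> K b -> K ((a + b) / 2).
Proof.
  intros HK Ha Hb; assert (H2 := C2_neq_0).
  replace ((a + b) / 2) with (a + RtoC (1 / 2) * (b - a)).
  - apply HK; auto; lra.
  - rewrite RtoC_div by lra; field; auto.
Qed.

Lemma tri_subtriangles K f T : convex K -> (forall z, K z -> Ccont f z) ->
  vertices_in K T -> tri f T = fold_right Cplus 0 (map (tri f) (subtriangles T)).
Proof.
  intros HK Hf; destruct T as [[a b] c]; intros [Ha [Hb Hc]]; simpl.
  assert (Kc := convex_mid K a b HK Ha Hb); assert (Ka := convex_mid K b c HK Hb Hc).
  assert (Kb := convex_mid K c a HK Hc Ha).
  rewrite (seg_split K f a b), (seg_split K f b c), (seg_split K f c a) by auto.
  rewrite (seg_opp K f ((a + b) / 2) ((c + a) / 2)), (seg_opp K f ((b + c) / 2) ((a + b) / 2)),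
    (seg_opp K f ((c + a) / 2) ((b + c) / 2)) by auto.
  ring.
Qed.

Lemma Cmod_half (z : C) : Cmod (z / 2) = (Cmod z / 2)%R.
Proof. rewrite Cmod_div, Cmod_R, Rabs_pos_eq by (apply C2_neq_0 || lra); auto. Qed.

(** The bound on the first vertices makes them, under iterated subdivision, a sequence with
    geometrically decreasing steps. *)
Lemma subtriangles_spec K T S : convex K -> vertices_in K T -> In S (subtriangles T) ->
  vertices_in K S /\ perimeter S = (perimeter T / 2)%R /\
  Cmod (fst (fst S) - fst (fst T)) <= perimeter T / 2.
Proof.
  intros HK; destruct T as [[a b] c]; intros [Ha [Hb Hc]] HS.
  assert (H2 := C2_neq_0).
  assert (Kc := convex_mid K a b HK Ha Hb); assert (Ka := convex_mid K b c HK Hb Hc).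
  assert (Kb := convex_mid K c a HK Hc Ha).
  assert (P1 := Cmod_ge_0 (b - a)); assert (P2 := Cmod_ge_0 (c - b));
  assert (P3 := Cmod_ge_0 (a - c)).
  assert (S1 := Cmod_sub_sym b a); assert (S2 := Cmod_sub_sym c b);
  assert (S3 := Cmod_sub_sym a c).
  assert (Q : forall x y u, x - y = u / 2 -> Cmod (x - y) = (Cmod u / 2)%R)
    by (intros x y u ->; apply Cmod_half).
  simpl in HS; destruct HS as [<-|[<-|[<-|[<-|[]]]]]; simpl; (split; [auto|]).
  - rewrite (Q ((a + b) / 2) a (b - a)), (Q ((c + a) / 2) ((a + b) / 2) (c - b)),
      (Q a ((c + a) / 2) (a - c)) by (field; auto).
    replace (a - a) with (RtoC 0) by ring; rewrite Cmod_0; lra.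
  - rewrite (Q b ((a + b) / 2) (b - a)), (Q ((b + c) / 2) b (c - b)),
      (Q ((a + b) / 2) ((b + c) / 2) (a - c)), (Q ((a + b) / 2) a (b - a))
      by (field; auto); lra.
  - rewrite (Q ((b + c) / 2) ((c + a) / 2) (b - a)), (Q c ((b + c) / 2) (c - b)),
      (Q ((c + a) / 2) c (a - c)), (Q ((c + a) / 2) a (c - a)) by (field; auto); lra.
  - rewrite (Q ((c + a) / 2) ((b + c) / 2) (a - b)), (Q ((a + b) / 2) ((c + a) / 2) (b - c)),
      (Q ((b + c) / 2) ((a + b) / 2) (c - a)),
      (Q ((b + c) / 2) a ((b - a) + (c - a))) by (field; auto).
    assert (A := Cmod_triangle (b - a) (c - a)); lra.
Qed.

Lemma Cmod_sum_le (l : list C) (M : R) :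
  (forall z, In z l -> Cmod z <= M) -> Cmod (fold_right Cplus 0 l) <= INR (length l) * M.
Proof.
  induction l as [|z l IH]; intros H.
  - simpl; rewrite Cmod_0; lra.
  - change (length (z :: l)) with (S (length l)); rewrite S_INR; simpl fold_right.
    eapply Rle_trans; [apply Cmod_triangle|].
    assert (A := H z (or_introl eq_refl)).
    assert (B := IH (fun w Hw => H w (or_intror Hw))); lra.
Qed.

Lemma subtriangle_large K f T : convex K -> (forall z, K z -> Ccont f z) ->
  vertices_in K T -> exists S, In S (subtriangles T) /\ Cmod (tri f T) / 4 <= Cmod (tri f S).
Proof.
  intros HK Hf HT; apply NNPP; intros N.
  assert (B : Cmod (tri f T) / 4 > 0 -> False).
  { intros P.
    (* Strict bounds on finitely many subtriangles give one strict bound M, and 4 M is still less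
       than the whole integral. *)
    assert (E : exists M, M < Cmod (tri f T) / 4 /\
      forall S, In S (subtriangles T) -> Cmod (tri f S) <= M).
    { assert (Q : forall l, (forall S, In S l -> Cmod (tri f S) < Cmod (tri f T) / 4) ->
        exists M, M < Cmod (tri f T) / 4 /\ forall S, In S l -> Cmod (tri f S) <= M).
      { induction l as [|S l IH]; intros H.
        - exists 0%R; split; [lra|intros S []].
        - destruct IH as [M [HM1 HM2]]; [intros; apply H; now right|].
          exists (Rmax M (Cmod (tri f S))); split.
          + apply Rmax_lub_lt; auto; apply H; now left.
          + intros S' [<-|H']; [apply Rmax_r|]; eapply Rle_trans; [now apply HM2|apply Rmax_l]. }
      apply Q; intros S HS; apply Rnot_le_lt; intros L; apply N; now exists S. }
    destruct E as [M [HM1 HM2]].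
    assert (L : Cmod (tri f T) <= INR 4 * M).
    { rewrite (tri_subtriangles K f T) by auto.
      replace 4%nat with (length (map (tri f) (subtriangles T)))
        by (destruct T as [[a b] c]; reflexivity).
      apply Cmod_sum_le; intros z Hz; apply in_map_iff in Hz.
      destruct Hz as [S [<- HS]]; auto. }
    simpl in L; lra. }
  (* What remains is a vanishing integral, for which any subtriangle serves. *)
  destruct T as [[a b] c] eqn:ET.
  apply N; exists (a, (a + b) / 2, (c + a) / 2); split; [now left|].
  assert (P := Cmod_ge_0 (tri f (a, b, c))).
  eapply Rle_trans; [|apply Cmod_ge_0]; apply Rnot_lt_le; intros L; now apply B.
Qed.

(** The intervals [u k - L/2^k, u k + L/2^k] are nested; the limit is the supremum of their left
    ends. *)
Lemma halving_seq_limit (u : nat -> R) (L : R) :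
  (forall k, Rabs (u (S k) - u k) <= L / 2 ^ S k) ->
  exists l, forall k, Rabs (u k - l) <= L / 2 ^ k.
Proof.
  intros H.
  assert (E : forall k, (L / 2 ^ k = L / 2 ^ S k + L / 2 ^ S k)%R).
  { intros k; simpl; field; apply pow_nonzero; lra. }
  assert (L0 : forall k, 0 <= L / 2 ^ S k) by (intros k; eapply Rle_trans; [apply Rabs_pos|apply H]).
  assert (Mv : forall k n, (u k - L / 2 ^ k <= u (k + n)%nat - L / 2 ^ (k + n))%R).
  { intros k n; induction n as [|n IH]; [rewrite Nat.add_0_r; lra|].
    rewrite Nat.add_succ_r; specialize (H (k + n)%nat); specialize (E (k + n)%nat).
    apply Rabs_le_between in H; lra. }
  assert (Mw : forall k n, (u (k + n)%nat + L / 2 ^ (k + n) <= u k + L / 2 ^ k)%R).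
  { intros k n; induction n as [|n IH]; [rewrite Nat.add_0_r; lra|].
    rewrite Nat.add_succ_r; specialize (H (k + n)%nat); specialize (E (k + n)%nat).
    apply Rabs_le_between in H; lra. }
  assert (V : forall n k, (u n - L / 2 ^ n <= u k + L / 2 ^ k)%R).
  { intros n k; assert (A := Mv n k); assert (B := Mw k n); rewrite (Nat.add_comm k n) in B.
    specialize (L0 (n + k)%nat); specialize (E (n + k)%nat); lra. }
  destruct (completeness (fun x => exists n, x = (u n - L / 2 ^ n)%R)) as [l [Hl1 Hl2]].
  - exists (u 0%nat + L / 2 ^ 0)%R; intros x [n ->]; apply V.
  - exists (u 0%nat - L / 2 ^ 0)%R; now exists 0%nat.
  - exists l; intros k; apply Rabs_le_between.
    assert (A := Hl1 _ (ex_intro _ k eq_refl)).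
    assert (B : l <= u k + L / 2 ^ k) by (apply Hl2; intros x [n ->]; apply V).
    lra.
Qed.

Lemma C_halving_seq_limit (u : nat -> C) (L : R) :
  (forall k, Cmod (u (S k) - u k) <= L / 2 ^ S k) ->
  exists l, forall k, Cmod (u k - l) <= 2 * (L / 2 ^ k).
Proof.
  intros H.
  destruct (halving_seq_limit (fun k => Re (u k)) L) as [x Hx].
  { intros k; eapply Rle_trans; [apply (re_le_Cmod (u (S k) - u k))|apply H]. }
  destruct (halving_seq_limit (fun k => Im (u k)) L) as [y Hy].
  { intros k; eapply Rle_trans; [apply (im_le_Cmod (u (S k) - u k))|apply H]. }
  exists (x, y); intros k; specialize (Hx k); specialize (Hy k).
  replace (u k - (x, y)) with (Re (u k) - x, Im (u k) - y)%R.
  - eapply Rle_trans; [apply Cmod_le_abs|lra].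
  - destruct (u k); reflexivity.
Qed.

Lemma tri_bound K f T M : convex K -> (forall z, K z -> Ccont f z) -> vertices_in K T ->
  (forall z, K z -> Cmod (z - fst (fst T)) <= perimeter T -> Cmod (f z) <= M) ->
  Cmod (tri f T) <= M * perimeter T.
Proof.
  intros HK Hf; destruct T as [[a b] c]; intros [Ha [Hb Hc]] HM; simpl in *.
  assert (P1 := Cmod_ge_0 (b - a)); assert (P2 := Cmod_ge_0 (c - b));
  assert (P3 := Cmod_ge_0 (a - c)).
  assert (B1 : Cmod (C_int f a b) <= M * Cmod (b - a)).
  { apply (seg_bound K); auto; intros t Ht; apply HM; [now apply HK|].
    replace (a + RtoC t * (b - a) - a) with (RtoC t * (b - a)) by ring.
    rewrite Cmod_mult, Cmod_R, Rabs_pos_eq by lra; nra. }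
  assert (B2 : Cmod (C_int f b c) <= M * Cmod (c - b)).
  { apply (seg_bound K); auto; intros t Ht; apply HM; [now apply HK|].
    replace (b + RtoC t * (c - b) - a) with ((b - a) + RtoC t * (c - b)) by ring.
    eapply Rle_trans; [apply Cmod_triangle|].
    rewrite Cmod_mult, Cmod_R, Rabs_pos_eq by lra; nra. }
  assert (B3 : Cmod (C_int f c a) <= M * Cmod (a - c)).
  { apply (seg_bound K); auto; intros t Ht; apply HM; [now apply HK|].
    replace (c + RtoC t * (a - c) - a) with (RtoC (1 - t) * (c - a)) by (rewrite RtoC_minus; ring).
    rewrite Cmod_mult, Cmod_R, Rabs_pos_eq, (Cmod_sub_sym c a) by lra; nra. }
  eapply Rle_trans; [apply Cmod_triangle|].
  assert (A := Cmod_triangle (C_int f a b) (C_int f b c)); lra.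
Qed.

Lemma tri_affine K T z l m : convex K -> vertices_in K T ->
  tri (fun w => l + m * (w - z)) T = 0.
Proof.
  intros HK; destruct T as [[a b] c]; intros [Ha [Hb Hc]]; simpl.
  assert (H2 := C2_neq_0).
  assert (D : forall w, Cder (fun w => l * w + m * ((w - z) * (w - z)) / 2) w (l + m * (w - z))).
  { intros w; eapply Cder_eq.
    - apply Cder_plus; [apply Cder_scal, Cder_id|].
      apply (Cder_ext (fun w => m / 2 * ((w - z) * (w - z)))); [intros; field; auto|].
      apply Cder_scal, Cder_mult; apply Cder_minus; apply Cder_id || apply Cder_const.
    - cbv beta; field; auto. }
  assert (Cc : forall w, K w -> Ccont (fun w => l + m * (w - z)) w).
  { intros w _; apply (Ccont_plus (fun _ => l)); [apply Ccont_const|].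
    apply (Ccont_mult (fun _ => m)); [apply Ccont_const|].
    eapply Cder_cont, Cder_minus; [apply Cder_id|apply Cder_const]. }
  rewrite !(seg_FTC K (fun w => l * w + m * ((w - z) * (w - z)) / 2)) by auto.
  ring.
Qed.

Lemma tri_minus K f g T : convex K -> (forall z, K z -> Ccont f z) ->
  (forall z, K z -> Ccont g z) -> vertices_in K T ->
  tri (fun z => f z - g z) T = tri f T - tri g T.
Proof.
  intros HK Hf Hg; destruct T as [[a b] c]; intros [Ha [Hb Hc]]; simpl.
  rewrite !(seg_minus K) by auto; ring.
Qed.

(** Triangles keeping at least a quarter of the integral shrink to a point of the closed set K. Near
    it f differs from an affine function, whose integral is zero, by e' times the distance. So the
    n-th integral is O(e' / 4^n), which compensates the factor 4^n. *)
Lemma goursat K f T : convex K -> closedC K -> (forall z, K z -> exists l, Cder f z l) ->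
  vertices_in K T -> tri f T = 0.
Proof.
  intros HK HK' Hd HT.
  assert (Hf : forall z, K z -> Ccont f z)
    by (intros z Hz; destruct (Hd z Hz) as [l Hl]; now apply Cder_cont in Hl).
  set (next := fun T => epsilon (inhabits T)
    (fun S => In S (subtriangles T) /\ Cmod (tri f T) / 4 <= Cmod (tri f S))).
  assert (Hn : forall T, vertices_in K T ->
    In (next T) (subtriangles T) /\ Cmod (tri f T) / 4 <= Cmod (tri f (next T))).
  { intros S HS; unfold next; apply epsilon_spec, (subtriangle_large K); auto. }
  set (t := fix t n := match n with O => T | S n => next (t n) end).
  assert (Hv : forall n, vertices_in K (t n)).
  { induction n as [|n IH]; auto; simpl.
    apply (subtriangles_spec K (t n)); auto; now apply Hn. }
  assert (Hp : forall n, perimeter (t n) = (perimeter T / 2 ^ n)%R).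
  { induction n as [|n IH]; simpl; [field|].
    destruct (subtriangles_spec K (t n) (next (t n)) HK (Hv n)) as [_ [-> _]]; [now apply Hn|].
    rewrite IH; field; apply pow_nonzero; lra. }
  assert (Hi : forall n, Cmod (tri f T) <= 4 ^ n * Cmod (tri f (t n))).
  { induction n as [|n IH]; simpl; [lra|].
    destruct (Hn (t n) (Hv n)) as [_ B].
    assert (0 < 4 ^ n) by (apply pow_lt; lra); nra. }
  destruct (C_halving_seq_limit (fun n => fst (fst (t n))) (perimeter T)) as [z Hz].
  { intros k; simpl t.
    destruct (subtriangles_spec K (t k) (next (t k)) HK (Hv k)) as [_ [_ B]]; [now apply Hn|].
    rewrite Hp in B; eapply Rle_trans; [exact B|].
    apply Req_le; simpl; field; apply pow_nonzero; lra. }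
  assert (P0 : 0 <= perimeter T).
  { destruct T as [[a b] c]; simpl; assert (P1 := Cmod_ge_0 (b - a));
    assert (P2 := Cmod_ge_0 (c - b)); assert (P3 := Cmod_ge_0 (a - c)); lra. }
  assert (Small : forall e, 0 < e -> exists n, perimeter T / 2 ^ n < e).
  { intros e He.
    destruct (pow_lt_1_zero (/ 2) ltac:(rewrite Rabs_pos_eq; lra) (e / (perimeter T + 1)))
      as [n Hn']; [apply Rdiv_lt_0_compat; lra|].
    exists n; specialize (Hn' n (le_n n)).
    rewrite pow_inv, Rabs_pos_eq in Hn'
      by (left; apply Rinv_0_lt_compat, pow_lt; lra).
    apply Rlt_div_r in Hn'; [|lra].
    assert (0 < / 2 ^ n) by (apply Rinv_0_lt_compat, pow_lt; lra).
    unfold Rdiv; nra. }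
  assert (Kz : K z).
  { apply HK'; intros e He; destruct (Small (e / 2)%R) as [n Hn']; [lra|].
    exists (fst (fst (t n))); split.
    - specialize (Hv n); destruct (t n) as [[a b] c]; apply Hv.
    - eapply Rle_lt_trans; [apply Hz|lra]. }
  destruct (Hd z Kz) as [m Hm]; rewrite Cder_eps in Hm.
  apply Cmod_0_eq; intros e He.
  set (L := perimeter T) in *.
  (* The last estimate comes out as e' * 3 L^2; the added 1 covers L = 0. *)
  set (e' := (e / (3 * L * L + 1))%R).
  assert (He' : 0 < e') by (apply Rdiv_lt_0_compat; nra).
  destruct (Hm e' He') as [d [Hd0 Hd1]].
  (* A point within one perimeter of the first vertex is within 3 L / 2^n of z: L / 2^n for the
     perimeter and twice that from [C_halving_seq_limit]. *)
  destruct (Small (d / 3)%R) as [n Hn']; [lra|].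
  specialize (Hv n); specialize (Hp n); specialize (Hi n); specialize (Hz n).
  assert (Ca : forall w, K w -> Ccont (fun w => f z + m * (w - z)) w).
  { intros w _; apply (Ccont_plus (fun _ => f z)); [apply Ccont_const|].
    apply (Ccont_mult (fun _ => m)); [apply Ccont_const|].
    eapply Cder_cont, Cder_minus; [apply Cder_id|apply Cder_const]. }
  assert (E : tri f (t n) = tri (fun w => f w - (f z + m * (w - z))) (t n)).
  { rewrite (tri_minus K), (tri_affine K) by auto; ring. }
  assert (B : Cmod (tri f (t n)) <= e' * (3 * (L / 2 ^ n)) * (L / 2 ^ n)).
  { rewrite E, <- Hp at 1; rewrite <- Hp; apply (tri_bound K); auto.
    - intros w Hw; apply Ccont_plus; auto.
      apply (Ccont_comp Copp); auto.
      intros r Hr; exists r; split; auto; intros x Hx.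
      replace (- x - - (f z + m * (w - z))) with (- (x - (f z + m * (w - z)))) by ring.
      now rewrite Cmod_opp.
    - intros w _ Hw; rewrite Hp in Hw |- *.
      assert (W : Cmod (w - z) <= 3 * (L / 2 ^ n)).
      { eapply Rle_trans; [apply (Cmod_triangle_sub _ (fst (fst (t n))))|lra]. }
      replace (f w - (f z + m * (w - z))) with (f w - f z - m * (w - z)) by ring.
      eapply Rle_trans; [apply Hd1; lra|].
      apply Rmult_le_compat_l; lra. }
  assert (P4 : 0 < 4 ^ n) by (apply pow_lt; lra).
  eapply Rle_trans; [apply Hi|].
  eapply Rle_trans; [apply Rmult_le_compat_l; [lra|exact B]|].
  replace (4 ^ n * (e' * (3 * (L / 2 ^ n)) * (L / 2 ^ n)))%R with (e' * (3 * L * L))%R.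
  - unfold e'; replace (e / (3 * L * L + 1) * (3 * L * L))%R with
      (e * ((3 * L * L) / (3 * L * L + 1)))%R by (field; nra).
    rewrite <- (Rmult_1_r e) at 2; apply Rmult_le_compat_l; [lra|].
    apply Rle_div_l; nra.
  - replace (4 ^ n)%R with (2 ^ n * 2 ^ n)%R by (rewrite <- Rpow_mult_distr; f_equal; lra).
    field; apply pow_nonzero; lra.
Qed.

Definition odisc (c : C) (r : R) (z : C) : Prop := Cmod (z - c) < r.
Definition cdisc (c : C) (r : R) (z : C) : Prop := Cmod (z - c) <= r.

Lemma cdisc_convex c r : convex (cdisc c r).
Proof.
  intros a b t Ha Hb Ht; unfold cdisc in *.
  replace (a + RtoC t * (b - a) - c) with (RtoC (1 - t) * (a - c) + RtoC t * (b - c))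
    by (rewrite RtoC_minus; ring).
  eapply Rle_trans; [apply Cmod_triangle|].
  rewrite !Cmod_mult, !Cmod_R, !Rabs_pos_eq by lra; nra.
Qed.

Lemma cdisc_closed c r : closedC (cdisc c r).
Proof.
  intros z H; unfold cdisc in *; apply Rnot_lt_le; intros N.
  destruct (H (Cmod (z - c) - r)%R) as [w [W1 W2]]; [lra|].
  assert (A := Cmod_triangle_sub z w c); rewrite (Cmod_sub_sym z w) in A; lra.
Qed.

Lemma disc_convex c r : convex (odisc c r).
Proof.
  intros a b t Ha Hb Ht; unfold odisc in *.
  replace (a + RtoC t * (b - a) - c) with (RtoC (1 - t) * (a - c) + RtoC t * (b - c))
    by (rewrite RtoC_minus; ring).
  eapply Rle_lt_trans; [apply Cmod_triangle|].
  rewrite !Cmod_mult, !Cmod_R, !Rabs_pos_eq by lra.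
  destruct (Req_dec t 0) as [->|n]; [lra|nra].
Qed.

Lemma disc_open c r : openC (odisc c r).
Proof.
  intros z Hz; exists (r - Cmod (z - c))%R; unfold odisc in *; split; [lra|].
  intros w Hw; assert (A := Cmod_triangle_sub w z c); lra.
Qed.

Lemma disc_center c r : 0 < r -> odisc c r c.
Proof. intros H; unfold odisc; replace (c - c) with (RtoC 0) by ring; now rewrite Cmod_0. Qed.

(** By Goursat on the triangle c, z, w, the difference of two values is the integral of f from z to
    w; continuity of f at z does the rest. *)
Lemma disc_primitive c R f : (forall z, odisc c R z -> exists l, Cder f z l) ->
  forall z, odisc c R z -> Cder (C_int f c) z (f z).
Proof.
  intros Hd z Hz.
  assert (Hc : forall z, odisc c R z -> Ccont f z)
    by (intros w Hw; destruct (Hd w Hw) as [l Hl]; now apply Cder_cont in Hl).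
  apply Cder_eps; intros e He.
  (* [goursat] asks for a closed set, so the argument runs in a closed disc whose radius s lies
     between |z - c| and R. *)
  unfold odisc in Hz; set (s := ((R + Cmod (z - c)) / 2)%R).
  assert (Hs : s < R) by (unfold s; lra).
  assert (HU : forall w, cdisc c s w -> odisc c R w)
    by (intros w Hw; unfold cdisc, odisc in *; lra).
  destruct (Hc z Hz e He) as [d [Hd0 Hd1]].
  exists (Rmin d (s - Cmod (z - c))); split; [apply Rmin_pos; unfold s; lra|intros w Hw].
  assert (W1 := Rlt_le_trans _ _ _ Hw (Rmin_l _ _)).
  assert (W2 := Rlt_le_trans _ _ _ Hw (Rmin_r _ _)).
  assert (P := Cmod_ge_0 (z - c)).
  assert (Kc : cdisc c s c).
  { unfold cdisc; replace (c - c) with (RtoC 0) by ring; rewrite Cmod_0; unfold s; lra. }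
  assert (Kz : cdisc c s z) by (unfold cdisc, s; lra).
  assert (Kw : cdisc c s w).
  { unfold cdisc; assert (A := Cmod_triangle_sub w z c); lra. }
  assert (Hcs : forall w, cdisc c s w -> Ccont f w) by auto.
  assert (G : tri f (c, z, w) = 0).
  { apply (goursat (cdisc c s)); [apply cdisc_convex|apply cdisc_closed|auto|simpl; auto]. }
  simpl in G; rewrite (seg_opp (cdisc c s) f c w) in G by (auto; apply cdisc_convex).
  assert (E1 : C_int (fun _ => f z) z w = f z * w - f z * z).
  { apply (seg_FTC (cdisc c s) (fun w => f z * w)); auto.
    - apply cdisc_convex.
    - intros; apply Ccont_const.
    - intros; eapply Cder_eq; [apply Cder_scal, Cder_id|]; ring. }
  replace (C_int f c w - C_int f c z - f z * (w - z)) with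
    (C_int (fun u => f u - f z) z w).
  2:{ rewrite (seg_minus (cdisc c s)), E1; auto.
      - replace (C_int f c w) with (C_int f c z + C_int f z w -
          (C_int f c z + C_int f z w + - C_int f c w)) by ring.
        rewrite G; ring.
      - apply cdisc_convex.
      - intros; apply Ccont_const. }
  apply (seg_bound (cdisc c s)); auto.
  - apply cdisc_convex.
  - intros u Hu; apply (Ccont_plus f (fun _ => - f z)); auto; apply Ccont_const.
  - intros t Ht; left; apply Hd1.
    replace (z + RtoC t * (w - z) - z) with (RtoC t * (w - z)) by ring.
    rewrite Cmod_mult, Cmod_R, Rabs_pos_eq by lra.
    assert (Q := Cmod_ge_0 (w - z)); nra.
Qed.

(** * Integrals over circles and Cauchy's estimate *)

(** The left side is the integral of f' - m along the segment. With m = 0 this is a Lipschitz bound,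
    with m = f'(x) a first-order expansion. *)
Lemma mean_value_ineq U f f' m e x y : convex U -> (forall z, U z -> Cder f z (f' z)) ->
  (forall z, U z -> Ccont f' z) -> (forall z, U z -> Cmod (f' z - m) <= e) ->
  U x -> U y -> Cmod (f y - f x - m * (y - x)) <= e * Cmod (y - x).
Proof.
  intros HU Hf Hc He Hx Hy.
  assert (Hc' : forall z, U z -> Ccont (fun z => f' z - m) z).
  { intros z Hz; apply (Ccont_plus f' (fun _ => - m)); auto; apply Ccont_const. }
  replace (f y - f x - m * (y - x)) with (C_int (fun z => f' z - m) x y).
  - apply (seg_bound U); auto.
  - rewrite (seg_FTC U (fun z => f z - m * z)); auto; [ring|].
    intros z Hz; eapply Cder_eq; [apply Cder_minus; [now apply Hf|apply Cder_scal, Cder_id]|].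
    ring.
Qed.

Lemma zero_derivative_const U f x y : convex U -> (forall z, U z -> Cder f z 0) ->
  U x -> U y -> f x = f y.
Proof.
  intros HU Hf Hx Hy.
  assert (B : Cmod (f y - f x - 0 * (y - x)) <= 0 * Cmod (y - x)).
  { apply (mean_value_ineq U f (fun _ => RtoC 0)); auto.
    - intros; apply Ccont_const.
    - intros; replace (RtoC 0 - 0) with (RtoC 0) by ring; rewrite Cmod_0; lra. }
  replace (f x) with (f y - (f y - f x - 0 * (y - x))) by ring.
  rewrite (Cmod_0_eq (f y - f x - 0 * (y - x))); [ring|].
  intros e He; lra.
Qed.

Lemma uniform_on_interval (P : R -> R -> Prop) (a b : R) :
  (forall t d d', P t d -> d' <= d -> P t d') ->
  (forall t0, a <= t0 <= b -> exists d, 0 < d /\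
     forall t, a <= t <= b -> Rabs (t - t0) < d -> P t d) ->
  exists d, 0 < d /\ forall t, a <= t <= b -> P t d.
Proof.
  intros Mono H.
  assert (C : forall t0, {d : posreal | a <= t0 <= b ->
    forall t, a <= t <= b -> Rabs (t - t0) < d -> P t d}).
  { intros t0; apply constructive_indefinite_description.
    destruct (classic (a <= t0 <= b)) as [h|h].
    - destruct (H t0 h) as [d [d0 Hd]]; now exists (mkposreal d d0).
    (* Outside [a, b] nothing is claimed, and the radius 1 is a default. *)
    - exists (mkposreal 1 Rlt_0_1); tauto. }
  destruct (compactness_value_1d a b (fun t => proj1_sig (C t))) as [d Hd].
  exists (d : R); split; [apply cond_pos|intros t Ht].
  apply NNPP; intros N; apply (Hd t Ht); intros [u [Hu [H1 H2]]]; apply N.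
  apply (Mono t (proj1_sig (C u))); auto; now apply (proj2_sig (C u)).
Qed.

(** Uniformity in t is what lets the remainder be integrated along the curve g. Near g(t0) the
    derivative varies by at most e, and [mean_value_ineq] turns this into the expansion. *)
Lemma uniform_differentiability U f f' g a b : openC U ->
  (forall z, U z -> Cder f z (f' z)) -> (forall z, U z -> Ccont f' z) ->
  contI g a b -> (forall t : R, a <= t <= b -> U (g (RtoC t))) ->
  forall e, 0 < e -> exists d, 0 < d /\ forall t : R, a <= t <= b ->
    forall h, Cmod h < d ->
      Cmod (f (g (RtoC t) + h) - f (g (RtoC t)) - f' (g (RtoC t)) * h) <= e * Cmod h.
Proof.
  intros HU Hf Hc Hg HgU e He.
  apply (uniform_on_interval (fun t d => forall h, Cmod h < d ->
      Cmod (f (g (RtoC t) + h) - f (g (RtoC t)) - f' (g (RtoC t)) * h) <= e * Cmod h)).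
  { intros t d d' H Hd h Hh; apply H; lra. }
  intros t0 Ht0; set (z0 := g (RtoC t0)).
  assert (Uz0 : U z0) by now apply HgU.
  destruct (Hc z0 Uz0 (e / 2)%R) as [n1 [N1 H1]]; [lra|].
  destruct (HU z0 Uz0) as [n2 [N2 H2]].
  set (n := Rmin n1 n2); assert (Hn : 0 < n) by now apply Rmin_pos.
  destruct (Hg t0 Ht0 (n / 2)%R) as [d1 [D1 H3]]; [lra|].
  exists (Rmin d1 (n / 2)); split; [apply Rmin_pos; lra|].
  intros t Ht Htt h Hh.
  assert (A := H3 (RtoC t)); rewrite <- RtoC_minus, Cmod_R in A.
  specialize (A (Rlt_le_trans _ _ _ Htt (Rmin_l _ _))); fold z0 in A.
  assert (Hh' := Rlt_le_trans _ _ _ Hh (Rmin_r _ _)).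
  set (x := g (RtoC t)) in *.
  assert (I1 : n <= n1) by apply Rmin_l; assert (I2 : n <= n2) by apply Rmin_r.
  assert (V1 : odisc z0 n x) by (unfold odisc; lra).
  assert (V2 : odisc z0 n (x + h)).
  { unfold odisc; replace (x + h - z0) with (h + (x - z0)) by ring.
    eapply Rle_lt_trans; [apply Cmod_triangle|lra]. }
  assert (B : Cmod (f (x + h) - f x - f' x * (x + h - x)) <= e * Cmod (x + h - x)).
  { apply (mean_value_ineq (odisc z0 n) f f'); auto.
    - apply disc_convex.
    - intros z Hz; apply Hf, H2; unfold odisc in Hz; lra.
    - intros z Hz; apply Hc, H2; unfold odisc in Hz; lra.
    - intros z Hz; unfold odisc in *.
      assert (K1 := H1 z ltac:(lra)); assert (K2 := H1 x ltac:(lra)).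
      eapply Rle_trans; [apply (Cmod_triangle_sub _ (f' z0))|].
      rewrite (Cmod_sub_sym (f' z0)); lra. }
  now replace (x + h - x) with h in B by ring.
Qed.

Lemma CI_param (k : C -> C -> C) (k' : C -> C) z d0 a b : a <= b -> 0 < d0 ->
  (forall w, Cmod (w - z) < d0 -> contI (k w) a b) -> contI k' a b ->
  (forall e, 0 < e -> exists d, 0 < d /\ forall w, Cmod (w - z) < d -> forall t : R, a <= t <= b ->
     Cmod (k w (RtoC t) - k z (RtoC t) - k' (RtoC t) * (w - z)) <= e * Cmod (w - z)) ->
  Cder (fun w => CI (k w) a b) z (CI k' a b).
Proof.
  intros Hab Hd0 Hk Hk' H; apply Cder_eps; intros e He.
  (* The added 1 keeps the denominator positive when a = b. *)
  destruct (H (e / (b - a + 1))%R) as [d [Hd H']]; [apply Rdiv_lt_0_compat; lra|].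
  exists (Rmin d d0); split; [now apply Rmin_pos|intros w Hw].
  assert (Kw : contI (k w) a b) by (apply Hk; eapply Rlt_le_trans; [exact Hw|apply Rmin_r]).
  assert (Kz : contI (k z) a b).
  { apply Hk; replace (z - z) with (RtoC 0) by ring; now rewrite Cmod_0. }
  assert (C1 : contI (fun t => (w - z) * k' t) a b).
  { intros t Ht; apply (Ccont_mult (fun _ => w - z)); [apply Ccont_const|auto]. }
  assert (Cm : forall f g, contI f a b -> contI g a b -> contI (fun t => f t - g t) a b).
  { intros f g Hf Hg t Ht; apply (Ccont_plus f (fun t => - g t)); auto.
    apply (Ccont_comp Copp); auto.
    intros r Hr; exists r; split; auto; intros x Hx.
    replace (- x - - g (RtoC t)) with (- (x - g (RtoC t))) by ring; now rewrite Cmod_opp. }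
  replace (CI (k w) a b - CI (k z) a b - CI k' a b * (w - z)) with
    (CI (fun t => (k w t - k z t) - (w - z) * k' t) a b).
  2:{ rewrite (CI_minus (fun t => k w t - k z t) (fun t => (w - z) * k' t)),
        (CI_minus (k w) (k z)), CI_scal; auto; ring. }
  eapply Rle_trans; [apply (CI_bound _ a b (e / (b - a + 1) * Cmod (w - z)))|]; auto.
  - intros t Ht; rewrite (Cmult_comm (w - z)); apply H'; auto.
    eapply Rlt_le_trans; [exact Hw|apply Rmin_l].
  - assert (P := Cmod_ge_0 (w - z)).
    replace ((b - a) * (e / (b - a + 1) * Cmod (w - z)))%R with
      (((b - a) / (b - a + 1)) * (e * Cmod (w - z)))%R by (field; lra).
    rewrite <- (Rmult_1_l (e * Cmod (w - z))) at 2.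
    apply Rmult_le_compat_r; [nra|]; apply Rle_div_l; lra.
Qed.

(** The argument p t + z q t covers both uses: p = a, q = e^{it} varies the radius of a circle, and
    p = r e^{it}, q = 1 varies its centre. *)
Lemma CI_param_comp U f f' (w p q : C -> C) z d0 a b : a <= b -> openC U ->
  (forall x, U x -> Cder f x (f' x)) -> (forall x, U x -> Ccont f' x) ->
  contI w a b -> contI p a b -> contI q a b ->
  (forall t : R, a <= t <= b -> Cmod (w (RtoC t)) <= 1) ->
  (forall t : R, a <= t <= b -> Cmod (q (RtoC t)) <= 1) ->
  0 < d0 -> (forall z', Cmod (z' - z) < d0 -> forall t : R, a <= t <= b ->
    U (p (RtoC t) + z' * q (RtoC t))) ->
  Cder (fun z => CI (fun t => w t * f (p t + z * q t)) a b) z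
    (CI (fun t => w t * (f' (p t + z * q t) * q t)) a b).
Proof.
  intros Hab HU Hf Hc Hw Hp Hq Bw Bq Hd0 HUz.
  assert (Hz : Cmod (z - z) < d0)
    by (replace (z - z) with (RtoC 0) by ring; now rewrite Cmod_0).
  assert (Hl : forall z', contI (fun t => p t + z' * q t) a b).
  { intros z' t Ht; apply Ccont_plus; auto; apply Ccont_mult; auto; apply Ccont_const. }
  apply (CI_param (fun z t => w t * f (p t + z * q t)) _ z d0); auto.
  - intros z' Hz' t Ht; apply Ccont_mult; auto.
    apply (Ccont_comp f (fun t => p t + z' * q t)); [now apply Hl|].
    eapply Cder_cont, Hf, HUz; auto.
  - intros t Ht; apply Ccont_mult; auto; apply Ccont_mult; auto.
    apply (Ccont_comp f' (fun t => p t + z * q t)); [now apply Hl|apply Hc, HUz; auto].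
  - intros e He.
    destruct (uniform_differentiability U f f' (fun t => p t + z * q t) a b HU Hf Hc (Hl z)
      (HUz z Hz) e He) as [d [Hd H]].
    exists d; split; auto; intros z' Hz' t Ht.
    assert (Qb := Bq t Ht); assert (Q0 := Cmod_ge_0 (q (RtoC t))).
    assert (Z0 := Cmod_ge_0 (z' - z)).
    assert (Hh : Cmod ((z' - z) * q (RtoC t)) <= Cmod (z' - z)) by (rewrite Cmod_mult; nra).
    specialize (H t Ht ((z' - z) * q (RtoC t)) ltac:(lra)); cbv beta in H.
    set (x := p (RtoC t) + z * q (RtoC t)) in *.
    replace (p (RtoC t) + z' * q (RtoC t)) with (x + (z' - z) * q (RtoC t))
      by (unfold x; ring).
    set (h := (z' - z) * q (RtoC t)) in *.
    replace (w (RtoC t) * f (x + h) - w (RtoC t) * f x -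
      w (RtoC t) * (f' x * q (RtoC t)) * (z' - z)) with
      (w (RtoC t) * (f (x + h) - f x - f' x * h)) by (unfold h; ring).
    rewrite Cmod_mult; assert (W := Bw t Ht); assert (W0 := Cmod_ge_0 (w (RtoC t))).
    assert (G0 := Cmod_ge_0 (f (x + h) - f x - f' x * h)).
    eapply Rle_trans; [apply Rmult_le_compat_r; [auto|exact W]|].
    rewrite Rmult_1_l; eapply Rle_trans; [exact H|].
    apply Rmult_le_compat_l; lra.
Qed.

Definition cis (n : Z) (t : C) : C := Cexp (Ci * (RtoC (IZR n) * t)).

Lemma cis_plus m n t : cis (m + n) t = cis m t * cis n t.
Proof. unfold cis; rewrite <- Cexp_plus, plus_IZR, RtoC_plus; f_equal; ring. Qed.

Lemma Cmod_cis n (t : R) : Cmod (cis n (RtoC t)) = 1%R.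
Proof.
  unfold cis; rewrite Cmod_Cexp.
  replace (Re _) with 0%R; [apply exp_0|].
  simpl; ring.
Qed.

Lemma Cder_cis n z : Cder (cis n) z (Ci * RtoC (IZR n) * cis n z).
Proof.
  eapply Cder_eq.
  - apply (Cder_comp Cexp (fun t => Ci * (RtoC (IZR n) * t))); [|apply Cder_Cexp].
    apply Cder_scal, Cder_scal, Cder_id.
  - unfold cis; ring.
Qed.

Lemma contI_cis n a b : contI (cis n) a b.
Proof. intros t _; eapply Cder_cont, Cder_cis. Qed.

Lemma cis_0 n : cis n 0 = 1.
Proof. unfold cis; rewrite <- Cexp_0; f_equal; ring. Qed.

Lemma cis_2PI : cis 1 (RtoC (2 * PI)) = 1.
Proof.
  transitivity (Cexp 0); [|apply Cexp_0]; rewrite <- (Cexp_2PI 0); unfold cis; f_equal; ring.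
Qed.

Lemma cis_0_l t : cis 0 t = 1.
Proof. unfold cis; rewrite <- Cexp_0; f_equal; ring. Qed.

Lemma cis_m_2PI n : cis (- Z.of_nat n) (RtoC (2 * PI)) = 1.
Proof.
  induction n as [|n IH]; [apply cis_0_l|].
  assert (E := cis_plus 1 (- Z.of_nat (S n)) (RtoC (2 * PI))).
  replace (1 + - Z.of_nat (S n))%Z with (- Z.of_nat n)%Z in E by lia.
  rewrite cis_2PI, IH in E; rewrite E; ring.
Qed.

Lemma CI_cis (n : nat) : n <> 0%nat -> CI (cis (- Z.of_nat n)) 0 (2 * PI) = 0.
Proof.
  intros Hn; assert (Pp := PI_RGT_0).
  assert (N : Ci * RtoC (IZR (- Z.of_nat n)) <> 0).
  { apply Cmult_neq_0; [apply Cmod_gt_0; rewrite Cmod_Ci; lra|].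
    intros K; apply RtoC_inj in K; apply eq_IZR in K; lia. }
  rewrite (CI_FTC (fun t => / (Ci * RtoC (IZR (- Z.of_nat n))) * cis (- Z.of_nat n) t)).
  - rewrite cis_m_2PI, cis_0; ring.
  - lra.
  - apply contI_cis.
  - intros t _; eapply Cder_eq; [apply Cder_scal, Cder_cis|].
    rewrite Cmult_assoc, Cinv_l by auto; ring.
Qed.

Lemma circle_in_disc (a z : C) r (t : R) : Cmod z < r -> odisc a r (a + z * cis 1 (RtoC t)).
Proof.
  intros H; unfold odisc; replace (a + z * cis 1 (RtoC t) - a) with (z * cis 1 (RtoC t)) by ring.
  now rewrite Cmod_mult, Cmod_cis, Rmult_1_r.
Qed.

(* [circle f a n z] is 2 pi times the [n]-th Fourier coefficient of
   t |-> f (a + z e^{it}). *)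
Definition circle (f : C -> C) (a : C) (n : nat) (z : C) : C :=
  CI (fun t => cis (- Z.of_nat n) t * f (a + z * cis 1 t)) 0 (2 * PI).

Lemma two_PI_ge_0 : 0 <= 2 * PI.
Proof. assert (Pp := PI_RGT_0); lra. Qed.

Lemma contI_circle f a z r : Cmod z < r -> (forall x, odisc a r x -> Ccont f x) ->
  contI (fun t => f (a + z * cis 1 t)) 0 (2 * PI).
Proof.
  intros Hz Hf t Ht; apply (Ccont_comp f (fun t => a + z * cis 1 t)).
  - apply Ccont_plus; [apply Ccont_const|]; apply Ccont_mult; [apply Ccont_const|].
    now apply (contI_cis 1 0 (2 * PI)).
  - apply Hf; now apply circle_in_disc.
Qed.

Lemma Cder_circle f f' a r n z : Cmod z < r ->
  (forall x, odisc a r x -> Cder f x (f' x)) -> (forall x, odisc a r x -> Ccont f' x) ->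
  Cder (circle f a n) z (CI (fun t => cis (- Z.of_nat n) t * (f' (a + z * cis 1 t) * cis 1 t)) 0 (2 * PI)).
Proof.
  intros Hz Hf Hc; apply (CI_param_comp (odisc a r) f f' (cis (- Z.of_nat n)) (fun _ => a) (cis 1) z
    (r - Cmod z)); auto.
  - apply two_PI_ge_0.
  - apply disc_open.
  - apply contI_cis.
  - intros t _; apply Ccont_const.
  - apply contI_cis.
  - intros; rewrite Cmod_cis; lra.
  - intros; rewrite Cmod_cis; lra.
  - lra.
  - intros z' Hz' t Ht; apply circle_in_disc.
    assert (A := Cmod_rtriangle z' z); lra.
Qed.

(** Differentiation in z brings out a factor e^{it}, which lowers the Fourier index by one. *)
Lemma Cder_circle_S f f' a r n z : Cmod z < r ->
  (forall x, odisc a r x -> Cder f x (f' x)) -> (forall x, odisc a r x -> Ccont f' x) ->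
  Cder (circle f a (S n)) z (circle f' a n z).
Proof.
  intros Hz Hf Hc; eapply Cder_eq; [apply (Cder_circle f f' a r); auto|].
  apply CI_ext; [apply two_PI_ge_0|]; intros t _.
  replace (- Z.of_nat n)%Z with (- Z.of_nat (S n) + 1)%Z by lia.
  rewrite cis_plus; ring.
Qed.

Lemma circle_at_0 f a n : n <> 0%nat -> circle f a n 0 = 0.
Proof.
  intros Hn; unfold circle.
  rewrite (CI_ext _ (fun t => f a * cis (- Z.of_nat n) t)).
  - rewrite CI_scal; [rewrite CI_cis; auto; ring|apply two_PI_ge_0|apply contI_cis].
  - apply two_PI_ge_0.
  - intros t _; replace (a + 0 * cis 1 (RtoC t)) with a by ring; ring.
Qed.

(** The mean value property. The derivative in z, at w, is the integral over a period of f'(a + w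
    e^{it}) e^{it}, which is the t-derivative of f(a + w e^{it}) / (i w). At w = 0 it is a multiple
    of the integral of e^{it}. *)
Lemma circle_0 f f' a r z : Cmod z < r ->
  (forall x, odisc a r x -> Cder f x (f' x)) -> (forall x, odisc a r x -> Ccont f' x) ->
  circle f a 0 z = RtoC (2 * PI) * f a.
Proof.
  intros Hz Hf Hc; assert (P0 := Cmod_ge_0 z); assert (T0 := two_PI_ge_0).
  assert (E0 : circle f a 0 0 = RtoC (2 * PI) * f a).
  { unfold circle; rewrite (CI_ext _ (fun _ => f a)).
    - rewrite CI_const by auto; f_equal; f_equal; ring.
    - auto.
    - intros t _; replace (- Z.of_nat 0)%Z with 0%Z by lia; rewrite cis_0_l.
      replace (a + 0 * cis 1 (RtoC t)) with a by ring; ring. }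
  rewrite <- E0; apply (zero_derivative_const (odisc 0 r)).
  - apply disc_convex.
  - intros w Hw; unfold odisc in Hw; replace (w - 0) with w in Hw by ring.
    eapply Cder_eq; [apply (Cder_circle f f' a r); auto|].
    rewrite (CI_ext _ (fun t => f' (a + w * cis 1 t) * cis 1 t)); auto.
    2:{ intros t _; replace (- Z.of_nat 0)%Z with 0%Z by lia; rewrite cis_0_l; ring. }
    assert (Cc : contI (fun t => f' (a + w * cis 1 t) * cis 1 t) 0 (2 * PI)).
    { intros t Ht; apply Ccont_mult; [|now apply (contI_cis 1 0 (2 * PI))].
      now apply (contI_circle f' a w r). }
    assert (Nc : Ci <> 0) by (apply Cmod_gt_0; rewrite Cmod_Ci; lra).
    destruct (classic (w = 0)) as [->|n].
    + rewrite (CI_ext _ (fun t => f' a * cis 1 t)); auto.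
      2:{ intros t _; replace (a + 0 * cis 1 (RtoC t)) with a by ring; ring. }
      rewrite (CI_FTC (fun t => f' a * (/ Ci * cis 1 t))); auto.
      * rewrite cis_2PI, cis_0; ring.
      * intros t Ht; apply (Ccont_mult (fun _ => f' a)); [apply Ccont_const|].
        now apply (contI_cis 1 0 (2 * PI)).
      * intros t _; apply Cder_scal; eapply Cder_eq; [apply Cder_scal, Cder_cis|].
        field; auto.
    + rewrite (CI_FTC (fun t => / (Ci * w) * f (a + w * cis 1 t))); auto.
      * rewrite cis_2PI, cis_0; ring.
      * intros t Ht; eapply Cder_eq.
        -- apply Cder_scal, (Cder_comp f); [|apply Hf, circle_in_disc; auto].
           apply Cder_plus; [apply Cder_const|apply Cder_scal, Cder_cis].
        -- field; auto.
  - unfold odisc; now replace (z - 0) with z by ring.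
  - unfold odisc; replace (RtoC 0 - 0) with (RtoC 0) by ring; rewrite Cmod_0; lra.
Qed.

(** Both sides vanish at z = 0, and by [Cder_circle_S] their derivatives agree, which is [circle_0]
    for f'. In the same way [circle_2] follows from [circle_1]. *)
Lemma circle_1 f f' f'' a r z : Cmod z < r ->
  (forall x, odisc a r x -> Cder f x (f' x)) -> (forall x, odisc a r x -> Cder f' x (f'' x)) ->
  (forall x, odisc a r x -> Ccont f'' x) ->
  circle f a 1 z = RtoC (2 * PI) * f' a * z.
Proof.
  intros Hz H1 H2 H3; assert (P0 := Cmod_ge_0 z).
  assert (Z0 : odisc 0 r 0) by (apply disc_center; lra).
  assert (E : circle f a 1 z - RtoC (2 * PI) * f' a * z = circle f a 1 0 - RtoC (2 * PI) * f' a * 0).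
  { apply (zero_derivative_const (odisc 0 r) (fun z => circle f a 1 z - RtoC (2 * PI) * f' a * z)); auto.
    - apply disc_convex.
    - intros w Hw; unfold odisc in Hw; replace (w - 0) with w in Hw by ring.
      eapply Cder_eq.
      + apply Cder_minus; [apply (Cder_circle_S f f' a r); auto|apply Cder_scal, Cder_id].
        intros x Hx; eapply Cder_cont, H2; auto.
      + rewrite (circle_0 f' f'' a r) by auto; ring.
    - unfold odisc; now replace (z - 0) with z by ring. }
  rewrite circle_at_0 in E by auto.
  replace (circle f a 1 z) with (circle f a 1 z - RtoC (2 * PI) * f' a * z + RtoC (2 * PI) * f' a * z)
    by ring.
  rewrite E; ring.
Qed.

Lemma circle_2 f f' f'' f''' a r z : Cmod z < r ->
  (forall x, odisc a r x -> Cder f x (f' x)) -> (forall x, odisc a r x -> Cder f' x (f'' x)) ->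
  (forall x, odisc a r x -> Cder f'' x (f''' x)) -> (forall x, odisc a r x -> Ccont f''' x) ->
  circle f a 2 z = RtoC PI * f'' a * (z * z).
Proof.
  intros Hz H1 H2 H3 H4; assert (P0 := Cmod_ge_0 z).
  assert (Z0 : odisc 0 r 0) by (apply disc_center; lra).
  assert (E : circle f a 2 z - RtoC PI * f'' a * (z * z) = circle f a 2 0 - RtoC PI * f'' a * (0 * 0)).
  { apply (zero_derivative_const (odisc 0 r) (fun z => circle f a 2 z - RtoC PI * f'' a * (z * z))); auto.
    - apply disc_convex.
    - intros w Hw; unfold odisc in Hw; replace (w - 0) with w in Hw by ring.
      eapply Cder_eq.
      + apply Cder_minus; [apply (Cder_circle_S f f' a r); auto|].
        * intros x Hx; eapply Cder_cont, H2; auto.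
        * apply Cder_scal, Cder_mult; apply Cder_id.
      + rewrite (circle_1 f' f'' f''' a r) by auto; rewrite RtoC_mult; ring.
    - unfold odisc; now replace (z - 0) with z by ring. }
  rewrite circle_at_0 in E by auto.
  replace (circle f a 2 z) with (circle f a 2 z - RtoC PI * f'' a * (z * z) + RtoC PI * f'' a * (z * z))
    by ring.
  rewrite E; ring.
Qed.

Lemma Cder_circle_center f f' c rho a n r : 0 <= r -> Cmod (a - c) + r < rho -> 
  (forall x, odisc c rho x -> Cder f x (f' x)) -> (forall x, odisc c rho x -> Ccont f' x) ->
  Cder (fun a => circle f a n (RtoC r)) a (circle f' a n (RtoC r)).
Proof.
  intros Hr Ha Hf Hc.
  assert (T0 := two_PI_ge_0).
  assert (Hin : forall a', Cmod (a' - a) < rho - r - Cmod (a - c) -> forall t : R,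
    odisc c rho (a' + RtoC r * cis 1 (RtoC t))).
  { intros a' Ha' t; unfold odisc.
    replace (a' + RtoC r * cis 1 (RtoC t) - c) with
      ((a' - a) + ((a - c) + RtoC r * cis 1 (RtoC t))) by ring.
    eapply Rle_lt_trans; [apply Cmod_triangle|].
    assert (A := Cmod_triangle (a - c) (RtoC r * cis 1 (RtoC t))).
    rewrite Cmod_mult, Cmod_R, Cmod_cis, Rabs_pos_eq in A by auto; lra. }
  assert (E : forall g a, circle g a n (RtoC r) =
    CI (fun t => cis (- Z.of_nat n) t * g (RtoC r * cis 1 t + a * 1)) 0 (2 * PI)).
  { intros g x; apply CI_ext; auto; intros t _; f_equal; f_equal; ring. }
  apply (Cder_ext (fun a => CI (fun t => cis (- Z.of_nat n) t * f (RtoC r * cis 1 t + a * 1)) 0 (2 * PI))).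
  { intros; now rewrite E. }
  eapply Cder_eq.
  - apply (CI_param_comp (odisc c rho) f f' (cis (- Z.of_nat n)) (fun t => RtoC r * cis 1 t)
      (fun _ => RtoC 1) a (rho - r - Cmod (a - c))); auto.
    + apply disc_open.
    + apply contI_cis.
    + intros t Ht; apply Ccont_mult; [apply Ccont_const|now apply (contI_cis 1 0 (2 * PI))].
    + intros t Ht; apply Ccont_const.
    + intros; rewrite Cmod_cis; lra.
    + intros; rewrite Cmod_1; lra.
    + lra.
    + intros z' Hz' t _; replace (RtoC r * cis 1 (RtoC t) + z' * 1) with
        (z' + RtoC r * cis 1 (RtoC t)) by ring; auto.
  - rewrite E; apply CI_ext; auto; intros t _; ring.
Qed.

(* Integrate [f] three times: the second-order coefficient formula for the
   triple primitive can then be differentiated three times in the centre. *)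
Lemma derivative_differentiable c R f f' : (forall z, odisc c R z -> Cder f z (f' z)) ->
  forall z, odisc c R z -> exists l, Cder f' z l.
Proof.
  intros Hf z Hz.
  assert (H1 : forall z, odisc c R z -> Cder (C_int f c) z (f z))
    by (apply disc_primitive; intros w Hw; exists (f' w); auto).
  set (f1 := C_int f c) in *.
  assert (H2 : forall z, odisc c R z -> Cder (C_int f1 c) z (f1 z))
    by (apply disc_primitive; intros w Hw; exists (f w); auto).
  set (f2 := C_int f1 c) in *.
  assert (H3 : forall z, odisc c R z -> Cder (C_int f2 c) z (f2 z))
    by (apply disc_primitive; intros w Hw; exists (f1 w); auto).
  set (f3 := C_int f2 c) in *.
  (* Half the distance to the boundary: circles of radius r stay in the disc for all centres near
     z. *)
  unfold odisc in Hz; set (r := ((R - Cmod (z - c)) / 2)%R).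
  assert (Hr : 0 < r) by (unfold r; lra).
  assert (Zr : Cmod (z - c) + r < R) by (unfold r; lra).
  assert (Hc : forall g g', (forall z, odisc c R z -> Cder g z (g' z)) ->
    forall z, odisc c R z -> Ccont g z) by (intros g g' H w Hw; eapply Cder_cont, H; auto).
  assert (Hl : forall a, Cmod (a - c) + r < R -> exists d, 0 < d /\
    forall a', Cmod (a' - a) < d -> Cmod (a' - c) + r < R).
  { intros a Ha; exists (R - r - Cmod (a - c))%R; split; [lra|]; intros a' Ha'.
    assert (A := Cmod_triangle_sub a' a c); lra. }
  set (k := / (RtoC PI * (RtoC r * RtoC r))).
  assert (K : RtoC PI * (RtoC r * RtoC r) <> 0).
  { assert (Pp := PI_RGT_0); repeat apply Cmult_neq_0; intros K; apply RtoC_inj in K; lra. }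
  assert (E1 : forall a, Cmod (a - c) + r < R -> k * circle f3 a 2 (RtoC r) = f1 a).
  { intros a Ha; assert (S : forall x, odisc a (R - Cmod (a - c)) x -> odisc c R x).
    { intros x Hx; unfold odisc in *; assert (A := Cmod_triangle_sub x a c); lra. }
    rewrite (circle_2 f3 f2 f1 f a (R - Cmod (a - c))).
    - unfold k; field; split; intros Q; apply K; rewrite Q; ring.
    - rewrite Cmod_R, Rabs_pos_eq; lra.
    - intros x Hx; now apply H3, S.
    - intros x Hx; now apply H2, S.
    - intros x Hx; now apply H1, S.
    - intros x Hx; now apply (Hc _ _ Hf), S. }
  (* The identity holds for all centres near a, so both sides may be differentiated there. *)
  assert (Step : forall u u' v v', (forall z, odisc c R z -> Cder u z (u' z)) ->
    (forall z, odisc c R z -> Ccont u' z) -> (forall z, odisc c R z -> Cder v z (v' z)) ->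
    (forall a, Cmod (a - c) + r < R -> k * circle u a 2 (RtoC r) = v a) ->
    forall a, Cmod (a - c) + r < R -> k * circle u' a 2 (RtoC r) = v' a).
  { intros u u' v v' Hu Hu' Hv E a Ha; destruct (Hl a Ha) as [d [Hd Hd']].
    apply (Cder_unique v a).
    - apply (Cder_local (fun a => k * circle u a 2 (RtoC r)) v _ _ d); auto.
      apply Cder_scal, (Cder_circle_center u u' c R); auto; lra.
    - apply Hv; unfold odisc; lra. }
  assert (E2 := Step f3 f2 f1 f H3 (Hc _ _ H2) H1 E1).
  assert (E3 := Step f2 f1 f f' H2 (Hc _ _ H1) Hf E2).
  (* [E3] writes f' as a circle integral of [f1], which depends differentiably on the centre because
     f1' = f is continuous. *)
  exists (k * circle f z 2 (RtoC r)); destruct (Hl z Zr) as [d [Hd Hd']].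
  apply (Cder_local (fun a => k * circle f1 a 2 (RtoC r)) f' _ _ d); auto.
  apply Cder_scal, (Cder_circle_center f1 f c R); auto; [lra|eauto].
Qed.

Definition hol (f : C -> C) (c : C) (r : R) : Prop :=
  forall z, odisc c r z -> Cder f z (C_derive f z).

Lemma hol_intro f c R : (forall z, odisc c R z -> exists l, Cder f z l) -> hol f c R.
Proof.
  intros H z Hz; destruct (H z Hz) as [l Hl]; now rewrite (C_derive_Cder f z l).
Qed.

Lemma hol_C_derive f c R : hol f c R -> hol (C_derive f) c R.
Proof. intros H; apply hol_intro; now apply (derivative_differentiable c R f). Qed.

Lemma hol_cont f c R z : hol f c R -> odisc c R z -> Ccont f z.
Proof. intros H Hz; eapply Cder_cont, H; auto. Qed.

Lemma hol_sub f c R c' R' : hol f c R -> Cmod (c' - c) + R' <= R -> hol f c' R'.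
Proof.
  intros H Hc z Hz; apply H; unfold odisc in *.
  assert (A := Cmod_triangle_sub z c' c); lra.
Qed.

Lemma circle_bound f a n r R M : 0 <= r < R -> hol f a R ->
  (forall z, Cmod (z - a) = r -> Cmod (f z) <= M) -> Cmod (circle f a n (RtoC r)) <= 2 * PI * M.
Proof.
  intros Hr Hf HM; unfold circle.
  eapply Rle_trans; [apply (CI_bound _ 0 (2 * PI) M)|lra].
  - apply two_PI_ge_0.
  - intros t Ht; apply Ccont_mult; [now apply (contI_cis _ 0 (2 * PI))|].
    apply (contI_circle f a (RtoC r) R); auto.
    + rewrite Cmod_R, Rabs_pos_eq; lra.
    + intros x Hx; eapply hol_cont; eauto.
  - intros t _; rewrite Cmod_mult, Cmod_cis, Rmult_1_l; apply HM.
    replace (a + RtoC r * cis 1 (RtoC t) - a) with (RtoC r * cis 1 (RtoC t)) by ring.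
    rewrite Cmod_mult, Cmod_cis, Cmod_R, Rabs_pos_eq; lra.
Qed.

(** At the centre the maximum principle is the mean value property [circle_0] with the trivial bound
    on the integral. Cauchy's estimate follows from [circle_1] in the same way. *)
Lemma max_modulus f a r R M : 0 <= r < R -> hol f a R ->
  (forall z, Cmod (z - a) = r -> Cmod (f z) <= M) -> Cmod (f a) <= M.
Proof.
  intros Hr Hf HM; assert (B := circle_bound f a 0 r R M Hr Hf HM).
  assert (Hf' := hol_C_derive f a R Hf); assert (Pp := PI_RGT_0).
  rewrite (circle_0 f (C_derive f) a R) in B; auto.
  - rewrite Cmod_mult, Cmod_R, Rabs_pos_eq in B by lra.
    apply Rmult_le_reg_l in B; lra.
  - rewrite Cmod_R, Rabs_pos_eq; lra.
  - intros x Hx; now apply (hol_cont _ a R).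
Qed.

Lemma cauchy_estimate f a r R M : 0 < r < R -> hol f a R ->
  (forall z, Cmod (z - a) = r -> Cmod (f z) <= M) -> Cmod (C_derive f a) <= M / r.
Proof.
  intros Hr Hf HM; assert (B := circle_bound f a 1 r R M ltac:(lra) Hf HM).
  assert (Hf' := hol_C_derive f a R Hf); assert (Hf'' := hol_C_derive _ a R Hf').
  assert (Pp := PI_RGT_0).
  rewrite (circle_1 f (C_derive f) (C_derive (C_derive f)) a R) in B; auto.
  - rewrite !Cmod_mult, !Cmod_R, !Rabs_pos_eq in B by lra.
    apply Rle_div_r; [lra|]; rewrite Rmult_assoc in B; apply Rmult_le_reg_l in B; lra.
  - rewrite Cmod_R, Rabs_pos_eq; lra.
  - intros x Hx; now apply (hol_cont _ a R).
Qed.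

(** * Logarithms, Borel-Caratheodory and Bloch *)

Lemma C_int_refl g a : C_int g a a = 0.
Proof. rewrite C_int_CI; ring. Qed.

(** The function h is the primitive of f'/f with value l at the centre, so f e^{-h} has derivative
    zero. That f'/f is differentiable at all rests on [derivative_differentiable]. *)
Lemma hol_log f c r l : hol f c r -> (forall z, odisc c r z -> f z <> 0) -> Cexp l = f c ->
  let h := fun z => l + C_int (fun w => C_derive f w / f w) c z in
  forall z, odisc c r z -> Cder h z (C_derive f z / f z) /\ Cexp (h z) = f z.
Proof.
  intros Hf Hn Hl h.
  assert (Hf' := hol_C_derive f c r Hf).
  assert (Dh : forall z, odisc c r z -> Cder h z (C_derive f z / f z)).
  { intros z Hz; eapply Cder_eq.
    - apply (Cder_plus (fun _ => l)); [apply Cder_const|].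
      apply (disc_primitive c r (fun w => C_derive f w / f w)); auto.
      intros w Hw; eexists; apply Cder_div; [apply Hf'|apply Hf|apply Hn]; auto.
    - cbv beta; ring. }
  intros z Hz; split; auto.
  assert (Hr : 0 < r) by (unfold odisc in Hz; assert (P := Cmod_ge_0 (z - c)); lra).
  assert (E : f z * Cexp (- h z) = f c * Cexp (- h c)).
  { apply (zero_derivative_const (odisc c r) (fun z => f z * Cexp (- h z))); auto.
    - apply disc_convex.
    - intros w Hw; eapply Cder_eq.
      + apply Cder_mult; [now apply Hf|].
        apply (Cder_comp Cexp (fun z => - h z)); [|apply Cder_Cexp].
        apply (Cder_ext (fun z => - (1) * h z)); [intros; ring|].
        apply Cder_scal, Dh; auto.
      + cbv beta; field; now apply Hn.
    - now apply disc_center. }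
  unfold h in E at 2; rewrite C_int_refl in E.
  replace (- (l + 0)) with (- l) in E by ring.
  rewrite !Cexp_opp, Hl in E.
  assert (N := Cexp_neq_0 (h z)).
  assert (N' : f c <> 0) by (apply Hn, disc_center; auto).
  rewrite Cinv_r in E by auto.
  transitivity (f z * / Cexp (h z) * Cexp (h z)); [rewrite E; ring|field; auto].
Qed.

Lemma entire_hol f c r : entire f -> hol f c r.
Proof. intros Hf; apply hol_intro; intros z _; now apply entire_Cder. Qed.

Lemma entire_der f z : entire f -> Cder f z (C_derive f z).
Proof. intros Hf; apply (entire_hol f z 1 Hf), disc_center; lra. Qed.

Lemma hol_entire f : (forall r, hol f 0 r) -> entire f.
Proof.
  intros H; apply entire_Cder; intros z; exists (C_derive f z).
  apply (H (Cmod z + 1)%R); unfold odisc; replace (z - 0) with z by ring; lra.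
Qed.

Lemma entire_C_derive f : entire f -> entire (C_derive f).
Proof. intros Hf; apply hol_entire; intros r; now apply hol_C_derive, entire_hol. Qed.

(** The formula in [hol_log] does not involve the radius, so the logarithms on all discs about 0 are
    one function. *)
Lemma entire_log f : entire f -> (forall z, f z <> 0) ->
  exists h, entire h /\ forall z, f z = Cexp (h z).
Proof.
  intros Hf Hn; destruct (Cexp_surj (f 0) (Hn 0)) as [l Hl].
  assert (H := fun r => hol_log f 0 r l (entire_hol f 0 r Hf) (fun z _ => Hn z) Hl).
  eexists; split.
  - apply hol_entire; intros r; apply hol_intro; intros z Hz; eexists; apply (H r z Hz).
  - intros z; symmetry; apply (H (Cmod z + 1)%R); unfold odisc.
    replace (z - 0) with z by ring; lra.
Qed.

Lemma Re_minus a b : Re (a - b) = (Re a - Re b)%R.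
Proof. reflexivity. Qed.

Lemma Re_mult_R w (x : R) : Re (w * RtoC x) = (Re w * x)%R.
Proof. destruct w; unfold Re; simpl; ring. Qed.

(* With B = A - Re h(a), the function (h - h(a)) / (2B - (h - h(a))) maps the
   disc into the unit disc. *)
Lemma borel_caratheodory_derivative h a r s A : 0 < s < r -> hol h a r ->
  (forall z, odisc a r z -> Re (h z) < A) -> Cmod (C_derive h a) <= 2 * (A - Re (h a)) / s.
Proof.
  intros Hs Hh HA.
  assert (Ha : odisc a r a) by (apply disc_center; lra).
  assert (HB := HA a Ha); set (B := (A - Re (h a))%R).
  assert (HB' : 0 < B) by (unfold B; lra).
  set (q := fun z => RtoC (2 * B) - (h z - h a)).
  assert (Rq : forall z, odisc a r z -> B < Re (q z)).
  { intros z Hz; specialize (HA z Hz); unfold q, B; rewrite !Re_minus; simpl; unfold B; lra. }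
  assert (Nq : forall z, odisc a r z -> q z <> 0).
  { intros z Hz K; specialize (Rq z Hz); rewrite K in Rq; simpl in Rq; lra. }
  assert (Dk : forall z, odisc a r z -> Cder (fun z => (h z - h a) / q z) z
     (((C_derive h z - 0) * q z - (h z - h a) * (0 - (C_derive h z - 0))) / (q z * q z))).
  { intros z Hz; apply (Cder_div (fun z => h z - h a) q); [| |now apply Nq]; unfold q.
    - apply (Cder_minus h (fun _ => h a)); [now apply Hh|apply Cder_const].
    - apply (Cder_minus (fun _ => RtoC (2 * B)) (fun z => h z - h a)); [apply Cder_const|].
      apply (Cder_minus h (fun _ => h a)); [now apply Hh|apply Cder_const]. }
  assert (Hk : hol (fun z => (h z - h a) / q z) a r)
    by (apply hol_intro; intros z Hz; eexists; now apply Dk).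
  assert (E := cauchy_estimate _ a s r 1 Hs Hk).
  rewrite (C_derive_Cder _ _ _ (Dk a Ha)) in E.
  assert (Q : q a = RtoC (2 * B)) by (unfold q; ring).
  rewrite Q in E.
  assert (N : RtoC (2 * B) <> 0) by (intros K; apply RtoC_inj in K; lra).
  replace (((C_derive h a - 0) * RtoC (2 * B) - (h a - h a) * (0 - (C_derive h a - 0))) /
    (RtoC (2 * B) * RtoC (2 * B))) with (C_derive h a / RtoC (2 * B)) in E by (field; auto).
  rewrite Cmod_div, Cmod_R, Rabs_pos_eq in E by (auto; lra).
  assert (G : Cmod (C_derive h a) / (2 * B) <= 1 / s).
  { apply E; intros z Hz.
    assert (Hz' : odisc a r z) by (unfold odisc; lra).
    rewrite Cmod_div by auto.
    apply Rle_div_l; [apply Cmod_gt_0; auto|]; rewrite Rmult_1_l.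
    (* Re (h z - h a) < B says that h z - h a is closer to 0 than to 2B; the squares of the two
       distances are compared. *)
    apply Rsqr_incr_0; try apply Cmod_ge_0; unfold Rsqr.
    assert (S1 := Cmod2_alt (h z - h a)); assert (S2 := Cmod2_alt (q z)).
    specialize (Rq z Hz').
    assert (R1 : Re (q z) = (2 * B - Re (h z - h a))%R) by (unfold q; simpl; ring).
    assert (R2 : Im (q z) = (- Im (h z - h a))%R) by (unfold q; simpl; ring).
    rewrite R1 in Rq; rewrite R1, R2 in S2.
    set (X := Re (h z - h a)) in *; set (Y := Im (h z - h a)) in *.
    assert (0 < B * (B - X)) by (apply Rmult_lt_0_compat; lra).
    apply (Rle_trans _ (X ^ 2 + Y ^ 2)); [right; rewrite <- S1; ring|].
    apply (Rle_trans _ ((2 * B - X) ^ 2 + (- Y) ^ 2)); [nra|right; rewrite <- S2; ring]. }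
  apply (Rmult_le_compat_r (2 * B)) in G; [|lra].
  fold B; replace (Cmod (C_derive h a)) with (Cmod (C_derive h a) / (2 * B) * (2 * B))%R
    by (field; lra).
  eapply Rle_trans; [exact G|]; apply Req_le; field; lra.
Qed.

Lemma Re_nonincreasing g g' : (forall t : R, 0 <= t <= 1 -> Cder g (RtoC t) (g' (RtoC t))) ->
  (forall t : R, 0 <= t <= 1 -> Re (g' (RtoC t)) <= 0) -> Re (g 1) <= Re (g 0).
Proof.
  intros Hg Hn.
  destruct (MVT_gen (fun t => Re (g (RtoC t))) 0 1 (fun t => Re (g' (RtoC t)))) as [t [Ht E]].
  - rewrite Rmin_left, Rmax_right by lra; intros t Ht.
    apply is_derive_Reals; intros e He.
    assert (H := Hg t ltac:(lra)); rewrite Cder_eps in H.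
    destruct (H (e / 2)%R ltac:(lra)) as [d [Hd H']].
    exists (mkposreal d Hd); intros x Nx Hx; simpl in Hx.
    specialize (H' (RtoC (t + x))); rewrite <- RtoC_minus in H'.
    replace (t + x - t)%R with x in H' by ring.
    rewrite !Cmod_R in H'; specialize (H' Hx).
    assert (B := Rle_trans _ _ _ (re_le_Cmod _) H').
    rewrite !Re_minus in B.
    rewrite Re_mult_R in B.
    apply Rabs_pos_lt in Nx as Px.
    replace ((Re (g (RtoC (t + x))) - Re (g (RtoC t))) / x - Re (g' (RtoC t)))%R with
      ((Re (g (RtoC (t + x))) - Re (g (RtoC t)) - Re (g' (RtoC t)) * x) / x)%R by (field; auto).
    unfold Rdiv; rewrite Rabs_mult, Rabs_inv; apply Rlt_div_l; [lra|nra].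
  - rewrite Rmin_left, Rmax_right by lra; intros t Ht.
    apply continuity_pt_filterlim; intros P [e He].
    destruct (Cder_cont _ _ _ (Hg t Ht) e (cond_pos e)) as [d [Hd H]].
    exists (mkposreal d Hd); intros s Hs; apply He.
    specialize (H (RtoC s)); rewrite <- RtoC_minus, Cmod_R in H; specialize (H Hs).
    eapply Rle_lt_trans; [|exact H]; apply (re_le_Cmod (g (RtoC s) - g (RtoC t))).
  - rewrite Rmin_left, Rmax_right in Ht by lra; specialize (Hn t Ht).
    change (RtoC 1) with (RtoC 1%R); nra.
Qed.

Lemma Cexp_real (x : R) : Cexp (RtoC x) = RtoC (exp x).
Proof.
  unfold Cexp; simpl; rewrite cos_0, sin_0; apply injective_projections; simpl; ring.
Qed.

(* Harnack-type growth: u = A - Re h satisfies |grad u| <= |h'| <= 2 u / r. *)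
Lemma borel_caratheodory h r A : 0 < r -> hol h 0 (3 * r) ->
  (forall z, odisc 0 (3 * r) z -> Re (h z) < A) ->
  forall z, Cmod z <= r -> Cmod (h z - h 0) <= 2 * exp 2 * (A - Re (h 0)).
Proof.
  intros Hr Hh HA.
  assert (D : forall z, Cmod z <= r -> odisc 0 (3 * r) z)
    by (intros z Hz; unfold odisc; replace (z - 0) with z by ring; lra).
  assert (B1 : forall z, Cmod z <= r -> Cmod (C_derive h z) <= 2 * (A - Re (h z)) / r).
  (* The disc of radius 2r about z lies in the one of radius 3r, and the estimate is taken at radius
     r. *)
  { intros z Hz; apply (borel_caratheodory_derivative h z (2 * r)); [lra| |].
    - apply (hol_sub h 0 (3 * r)); auto; replace (z - 0) with z by ring; lra.
    - intros w Hw; apply HA; unfold odisc in *; assert (T := Cmod_triangle_sub w z 0).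
      replace (z - 0) with z in T by ring; lra. }
  assert (U : forall z, Cmod z <= r -> A - Re (h z) <= exp 2 * (A - Re (h 0))).
  { intros z Hz.
    (* A Gronwall argument along the ray to z: since |z| <= r, A - Re h grows at rate at most 2 (A -
       Re h), so multiplying by e^{-2s} makes it nonincreasing. Hence the constant e^2. *)
    assert (M := Re_nonincreasing (fun s => (RtoC A - h (s * z)) * Cexp (RtoC (-2) * s))
      (fun s => (- (C_derive h (s * z) * z) - RtoC 2 * (RtoC A - h (s * z))) * Cexp (RtoC (-2) * s))).
    assert (Hs : forall t : R, 0 <= t <= 1 -> Cmod (RtoC t * z) <= r).
    { intros t Ht; rewrite Cmod_mult, Cmod_R, Rabs_pos_eq by lra.
      assert (P := Cmod_ge_0 z); nra. }
    cbv beta in M; replace (1 * z) with z in M by ring; replace (0 * z) with (RtoC 0) in M by ring.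
    replace (RtoC (-2) * 1) with (RtoC (-2)) in M by ring.
    replace (RtoC (-2) * 0) with (RtoC 0) in M by ring.
    rewrite !Cexp_real, exp_0 in M.
    rewrite !Re_mult_R, !Re_minus in M; change (Re (RtoC A)) with A in M.
    assert (M' : (A - Re (h z)) * exp (-2) <= (A - Re (h 0)) * 1).
    { apply M.
      - intros t Ht; eapply Cder_eq.
        + apply Cder_mult.
          * apply Cder_minus; [apply Cder_const|].
            apply (Cder_comp h (fun s => s * z)); [|apply Hh, D, Hs; auto].
            apply Cder_mult; [apply Cder_id|apply Cder_const].
          * apply (Cder_comp Cexp (fun s => RtoC (-2) * s)); [|apply Cder_Cexp].
            apply Cder_scal, Cder_id.
        + cbv beta; ring.
      - intros t Ht; rewrite <- RtoC_mult, Cexp_real, Re_mult_R, !Re_minus.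
        assert (P := exp_pos (-2 * t)); specialize (Hs t Ht).
        assert (K := B1 _ Hs); assert (P0 := HA _ (D _ Hs)).
        set (w := RtoC t * z) in *.
        replace (Re (RtoC 2 * (RtoC A - h w))) with (2 * (A - Re (h w)))%R
          by (rewrite Cmult_comm, Re_mult_R, Re_minus; change (Re (RtoC A)) with A; ring).
        replace (Re (- (C_derive h w * z))) with (- Re (C_derive h w * z))%R by reflexivity.
        assert (Q := re_le_Cmod (C_derive h w * z)); rewrite Cmod_mult in Q.
        assert (Q' := Rabs_le_between (Re (C_derive h w * z)) (Cmod (C_derive h w) * Cmod z)).
        apply Q' in Q.
        apply Rle_div_r in K; [|lra].
        assert (Z0 := Cmod_ge_0 z); assert (Z1 := Cmod_ge_0 (C_derive h w)).
        assert (Cmod (C_derive h w) * Cmod z <= Cmod (C_derive h w) * r) by nra.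
        nra. }
    replace (-2)%R with (- (2))%R in M' by ring; rewrite exp_Ropp in M'.
    assert (P := exp_pos 2).
    apply (Rmult_le_reg_r (/ exp 2)); [now apply Rinv_0_lt_compat|].
    eapply Rle_trans; [exact M'|]; apply Req_le; field; lra. }
  intros z Hz.
  assert (Z0 := Cmod_ge_0 z).
  assert (V : Cmod (h z - h 0 - 0 * (z - 0)) <= 2 * exp 2 * (A - Re (h 0)) / r * Cmod (z - 0)).
  { apply (mean_value_ineq (cdisc 0 r) h (C_derive h)).
    - apply cdisc_convex.
    - intros w Hw; unfold cdisc in Hw; replace (w - 0) with w in Hw by ring; now apply Hh, D.
    - intros w Hw; unfold cdisc in Hw; replace (w - 0) with w in Hw by ring.
      apply (hol_cont _ 0 (3 * r)); [now apply hol_C_derive|now apply D].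
    - intros w Hw; unfold cdisc in Hw; replace (w - 0) with w in Hw by ring.
      replace (C_derive h w - 0) with (C_derive h w) by ring.
      eapply Rle_trans; [now apply B1|]; apply Rmult_le_compat_r; [left; now apply Rinv_0_lt_compat|].
      specialize (U w Hw); lra.
    - unfold cdisc; replace (RtoC 0 - 0) with (RtoC 0) by ring; rewrite Cmod_0; lra.
    - unfold cdisc; replace (z - 0) with z by ring; auto. }
  replace (h z - h 0 - 0 * (z - 0)) with (h z - h 0) in V by ring.
  replace (z - 0) with z in V by ring.
  eapply Rle_trans; [exact V|].
  assert (H0 : 0 < A - Re (h 0)).
  { assert (K := HA 0 (disc_center 0 (3 * r) ltac:(lra))); lra. }
  assert (P := exp_pos 2).
  unfold Rdiv; rewrite Rmult_assoc; rewrite <- (Rmult_1_r (2 * exp 2 * (A - Re (h 0)))) at 2.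
  apply Rmult_le_compat_l; [nra|].
  rewrite Rmult_comm; apply Rle_div_l; lra.
Qed.

(** [compactness_list] works on boxes, so the closed disc is put in a square, each point of which
    gets a neighbourhood and a bound. *)
Lemma bounded_on_cdisc g c r s : s < r -> (forall z, odisc c r z -> Ccont g z) ->
  exists M, forall z, cdisc c s z -> Cmod (g z) <= M.
Proof.
  intros Hs Hg.
  assert (Loc : forall t : Compactness.Tn 2 R, {p : posreal * R |
    forall z, cdisc c s z -> Rabs (Re z - fst t) < fst p -> Rabs (Im z - fst (snd t)) < fst p ->
      Cmod (g z) <= snd p}).
  { intros [x [y []]]; apply constructive_indefinite_description; simpl.
    assert (Tr : forall z (d : R), Rabs (Re z - x) < d / 2 -> Rabs (Im z - y) < d / 2 ->
      Cmod (z - (x, y)) < d).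
    { intros z d H1 H2; replace (z - (x, y)) with (Re z - x, Im z - y)%R by (destruct z; reflexivity).
      eapply Rle_lt_trans; [apply Cmod_le_abs|lra]. }
    destruct (Rlt_dec (Cmod ((x, y) - c)) r) as [h|h].
    - destruct (Ccont_bounded g (x, y) (Hg _ h)) as [d [Hd H]].
      exists (mkposreal (d / 2) ltac:(lra), Cmod (g (x, y)) + 1)%R; simpl.
      intros z _ H1 H2; now apply H, Tr.
    (* Around a point outside the open disc the neighbourhood misses the closed disc, so the bound 0
       is vacuous there. *)
    - exists (mkposreal ((r - s) / 2) ltac:(lra), 0%R); simpl.
      intros z Hz H1 H2; exfalso; specialize (Tr z _ H1 H2); unfold cdisc in Hz.
      assert (A := Cmod_triangle_sub (x, y) z c); rewrite (Cmod_sub_sym (x, y) z) in A; lra. }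
  set (a := (Re c - s, (Im c - s, tt))%R : Compactness.Tn 2 R).
  set (b := (Re c + s, (Im c + s, tt))%R : Compactness.Tn 2 R).
  assert (L := compactness_list 2 a b (fun t => fst (proj1_sig (Loc t)))).
  apply NNPP in L; destruct L as [l Hl].
  assert (Max : exists M, forall t, In t l -> snd (proj1_sig (Loc t)) <= M).
  { clear Hl; induction l as [|t l [M HM]]; [exists 0%R; intros t []|].
    exists (Rmax M (snd (proj1_sig (Loc t)))); intros u [<-|Hu]; [apply Rmax_r|].
    eapply Rle_trans; [now apply HM|apply Rmax_l]. }
  destruct Max as [M HM]; exists M; intros z Hz.
  assert (Z1 := re_le_Cmod (z - c)); assert (Z2 := im_le_Cmod (z - c)); unfold cdisc in Hz.
  change (Re (z - c)) with (Re z - Re c)%R in Z1; change (Im (z - c)) with (Im z - Im c)%R in Z2.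
  apply Rabs_le_between in Z1; apply Rabs_le_between in Z2.
  destruct (Hl (Re z, (Im z, tt))) as [t [T1 [T2 T3]]].
  { simpl; repeat split; lra. }
  eapply Rle_trans; [|apply HM, T1].
  destruct (Loc t) as [p Hp]; simpl in *; destruct t as [x [y []]]; simpl in *.
  apply Hp; [exact Hz|apply T3|apply T3].
Qed.

(** Landau's argument. Where |h'(z)| (s - |z|) nearly attains its supremum, h is almost linear on a
    disc of comparable radius, so its image contains a disc about h(z0). The value 1024 makes the
    radius of that disc exceed 4, and an omitted value within 4 is then impossible. *)
Lemma bloch h r s : 0 < s < r -> hol h 0 r ->
  (forall w, exists v, Cmod (v - w) <= 4 /\ forall z, odisc 0 r z -> h z <> v) ->
  forall z, Cmod z <= s -> Cmod (C_derive h z) * (s - Cmod z) <= 1024.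
Proof.
  intros Hs Hh Hv.
  assert (Hh' := hol_C_derive h 0 r Hh).
  destruct (bounded_on_cdisc (C_derive h) 0 r s) as [M HM]; [lra|intros; now apply (hol_cont _ 0 r)|].
  assert (Z0 : forall z : C, z - 0 = z) by (intros; ring).
  set (val := fun z => (Cmod (C_derive h z) * (s - Cmod z))%R).
  destruct (completeness (fun x => exists z, Cmod z <= s /\ x = val z)) as [m [Hm1 Hm2]].
  - exists (M * s)%R; intros x [z [Hz ->]]; unfold val.
    assert (A := HM z); unfold cdisc in A; rewrite Z0 in A; specialize (A Hz).
    assert (P := Cmod_ge_0 z); assert (P' := Cmod_ge_0 (C_derive h z)); nra.
  - exists (val 0), 0; split; auto; rewrite Cmod_0; lra.
  - assert (Up : forall z, Cmod z <= s -> val z <= m) by (intros z Hz; apply Hm1; eauto).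
    destruct (Rle_dec m 1024) as [L|L].
    { intros z Hz; eapply Rle_trans; [now apply Up|auto]. }
    exfalso; apply Rnot_le_lt in L.
    (* A point within a factor 2 of the supremum is enough, so the supremum need not be attained. *)
    assert (Ex : exists z0, Cmod z0 <= s /\ m / 2 < val z0).
    { apply NNPP; intros N.
      assert (K : m <= m / 2).
      { apply Hm2; intros x [z [Hz ->]]; apply Rnot_lt_le; intros K; apply N; eauto. }
      lra. }
    destruct Ex as [z0 [Hz0 V0]]; unfold val in V0.
    set (p := Cmod (C_derive h z0)) in *.
    assert (P0 : 0 <= p) by apply Cmod_ge_0.
    set (q := ((s - Cmod z0) / 2)%R).
    assert (Pq : m / 2 < p * (2 * q)) by (unfold q; lra).
    assert (Q0 : 0 < q).
    { destruct (Req_dec q 0) as [K|K]; [rewrite K in Pq; lra|unfold q in *; lra]. }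
    assert (P1 : 0 < p) by nra.
    assert (In : forall z, odisc z0 q z -> Cmod z < s - q).
    { intros z Hz; unfold odisc in Hz; assert (A := Cmod_rtriangle z z0); unfold q in *; lra. }
    (* Here s - |z0| = 2q and s - |z| > q, so |h'(z)| q <= m < 4 p q. *)
    assert (Hq : forall z, odisc z0 q z -> Cmod (C_derive h z) <= 4 * p).
    { intros z Hz; specialize (In z Hz); assert (A := Up z ltac:(lra)); unfold val in A.
      assert (A' := Cmod_ge_0 (C_derive h z)).
      apply (Rmult_le_reg_r q); auto; nra. }
    assert (Hsub : forall a t, Cmod (a - z0) + t <= q -> hol h a t).
    { intros a t Ha; apply (hol_sub h 0 r); auto; rewrite Z0.
      assert (A := Cmod_rtriangle a z0); unfold q in *; lra. }
    (* Cauchy's estimate at radius q/2 for h', bounded by 4p. On radius q/16 the derivative h' then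
       varies by at most p/2, half its value at z0. *)
    assert (H2 : forall z, cdisc z0 (q / 16) z -> Cmod (C_derive (C_derive h) z) <= 8 * p / q).
    { intros z Hz; unfold cdisc in Hz.
      replace (8 * p / q)%R with (4 * p / (q / 2))%R by (field; lra).
      apply (cauchy_estimate _ z (q / 2) (3 * q / 4)); [lra|apply hol_C_derive, Hsub; lra|].
      intros w Hw; apply Hq; unfold odisc; assert (A := Cmod_triangle_sub w z z0); lra. }
    assert (Cin : cdisc z0 (q / 16) z0).
    { unfold cdisc; replace (z0 - z0) with (RtoC 0) by ring; rewrite Cmod_0; lra. }
    assert (Oin : forall z, cdisc z0 (q / 16) z -> odisc z0 q z)
      by (intros z Hz; unfold odisc, cdisc in *; lra).
    assert (Hz0q : hol h z0 q).
    { apply Hsub; replace (z0 - z0) with (RtoC 0) by ring; rewrite Cmod_0; lra. }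
    assert (Hz1q := hol_C_derive h z0 q Hz0q); assert (Hz2q := hol_C_derive _ z0 q Hz1q).
    assert (H1 : forall z, cdisc z0 (q / 16) z -> Cmod (C_derive h z - C_derive h z0) <= p / 2).
    { intros z Hz.
      assert (V : Cmod (C_derive h z - C_derive h z0 - 0 * (z - z0)) <= 8 * p / q * Cmod (z - z0)).
      { apply (mean_value_ineq (cdisc z0 (q / 16)) (C_derive h) (C_derive (C_derive h))); auto.
        - apply cdisc_convex.
        - intros w Hw; apply (hol_cont _ z0 q); auto.
        - intros w Hw; rewrite Z0; auto. }
      replace (C_derive h z - C_derive h z0 - 0 * (z - z0)) with
        (C_derive h z - C_derive h z0) in V by ring.
      eapply Rle_trans; [exact V|].
      replace (p / 2)%R with (8 * p / q * (q / 16))%R by (field; lra).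
      apply Rmult_le_compat_l; [|exact Hz].
      apply Rmult_le_pos; [lra|left; now apply Rinv_0_lt_compat]. }
    set (rho := (q / 16)%R) in *.
    assert (Lw : forall z, Cmod (z - z0) = rho -> p * rho / 2 <= Cmod (h z - h z0)).
    { intros z Hz.
      assert (V : Cmod (h z - h z0 - C_derive h z0 * (z - z0)) <= p / 2 * Cmod (z - z0)).
      { apply (mean_value_ineq (cdisc z0 rho) h (C_derive h)); auto.
        - apply cdisc_convex.
        - intros w Hw; apply (hol_cont _ z0 q); auto.
        - unfold cdisc; lra. }
      rewrite Cmod_sub_sym in V.
      assert (A := Cmod_rtriangle (C_derive h z0 * (z - z0)) (h z - h z0)).
      rewrite Cmod_mult, Hz in A; rewrite Hz in V; fold p in A; lra. }
    destruct (Hv (h z0)) as [v [V1 V2]].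
    assert (Nv : forall z, odisc z0 q z -> h z - v <> 0).
    { intros z Hz K; apply (V2 z).
      - unfold odisc; rewrite Z0; specialize (In z Hz); lra.
      - replace (h z) with (h z - v + v) by ring; rewrite K; ring. }
    assert (Pr : 16 < p * rho) by (unfold rho; nra).
    assert (Oz0 : odisc z0 q z0) by now apply disc_center.
    (* On the circle of radius rho, |h - h(z0)| >= p rho / 2 > 8, so |h - v| > 4 there, while |h(z0)
       - v| <= 4: the function 1/(h - v) violates the maximum principle. *)
    assert (MM : Cmod (/ (h z0 - v)) <= / (p * rho / 2 - 4)).
    { apply (max_modulus (fun z => / (h z - v)) z0 rho q).
      - unfold rho; lra.
      - apply hol_intro; intros z Hz; eexists; apply (Cder_inv (fun z => h z - v)); auto.
        apply Cder_minus; [now apply Hz0q|apply Cder_const].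
      - intros z Hz.
        assert (Oz : odisc z0 q z) by (apply Oin; unfold cdisc; lra).
        rewrite Cmod_inv by auto; apply Rinv_le_contravar; [lra|].
        specialize (Lw z Hz); assert (A := Cmod_triangle_sub (h z) v (h z0)); lra. }
    rewrite Cmod_inv in MM by auto.
    assert (Pv := proj1 (Cmod_gt_0 _) (Nv z0 Oz0)); rewrite Cmod_sub_sym in V1.
    assert (K : / (p * rho / 2 - 4) < / Cmod (h z0 - v)) by (apply Rinv_lt_contravar; nra).
    lra.
Qed.

(** * Growth of composites *)

Lemma Cexp_2PI_Z (k : Z) (z : C) : Cexp (z + Ci * RtoC (2 * PI * IZR k)) = Cexp z.
Proof.
  assert (N : forall (n : nat) z, Cexp (z + Ci * RtoC (2 * PI * INR n)) = Cexp z).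
  { induction n as [|n IH]; intros w.
    - simpl; rewrite Rmult_0_r; f_equal; ring.
    - rewrite S_INR, <- (IH w), <- (Cexp_2PI (w + Ci * RtoC (2 * PI * INR n))).
      f_equal; rewrite Rmult_plus_distr_l, RtoC_plus, Rmult_1_r; ring. }
  destruct (Z_le_gt_dec 0 k) as [h|h].
  - rewrite <- (Z2Nat.id k h), <- INR_IZR_INZ; apply N.
  - rewrite <- (N (Z.to_nat (- k)) (z + _)); f_equal.
    rewrite INR_IZR_INZ, Z2Nat.id by lia; rewrite opp_IZR.
    replace (2 * PI * - IZR k)%R with (- (2 * PI * IZR k))%R by ring.
    rewrite RtoC_opp; ring.
Qed.

(** The sharp bound is pi; 4 is a convenient integer above it. *)
Lemma nearest_mod_2PI (x y : R) : exists k : Z, Rabs (x + 2 * PI * IZR k - y) <= 4.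
Proof.
  assert (Pp := PI_RGT_0); assert (P4 := PI_4).
  (* [up q] lies in (q, q + 1], and the shift by 1/2 centres the error at 0. *)
  set (q := ((y - x) / (2 * PI) - 1 / 2)%R).
  destruct (archimed q) as [A1 A2]; exists (up q).
  assert (E : (y - x = 2 * PI * (q + 1 / 2))%R) by (unfold q; field; lra).
  replace (x + 2 * PI * IZR (up q) - y)%R with (2 * PI * (IZR (up q) - q - 1 / 2))%R by lra.
  rewrite Rabs_mult, (Rabs_pos_eq (2 * PI)) by lra.
  assert (Rabs (IZR (up q) - q - 1 / 2) <= 1 / 2) by (apply Rabs_le_between; lra).
  assert (0 <= Rabs (IZR (up q) - q - 1 / 2)) by apply Rabs_pos.
  nra.
Qed.

(* The logarithm of g - u omits a point of every closed disc of radius 4, so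
   Bloch's theorem makes it Lipschitz. *)
Lemma growth_of_omitting g u r : 0 < r -> hol g 0 (3 * r) ->
  (forall z, odisc 0 (3 * r) z -> g z <> u) ->
  (forall rho, 0 < rho -> exists v, Cmod (v - u) = rho /\ forall z, odisc 0 (3 * r) z -> g z <> v) ->
  forall z, Cmod z <= r -> Cmod (g z - u) <= exp 1024 * Cmod (g 0 - u).
Proof.
  intros Hr Hg Hu Hv.
  assert (Z0 : forall z : C, z - 0 = z) by (intros; ring).
  assert (O0 : odisc 0 (3 * r) 0) by (apply disc_center; lra).
  assert (Dg : forall z, odisc 0 (3 * r) z -> Cder (fun z => g z - u) z (C_derive g z)).
  { intros z Hz; eapply Cder_eq; [apply (Cder_minus g (fun _ => u)); [now apply Hg|apply Cder_const]|].
    ring. }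
  assert (Nz : forall z, odisc 0 (3 * r) z -> g z - u <> 0).
  { intros z Hz K; apply (Hu z Hz); replace (g z) with (g z - u + u) by ring; rewrite K; ring. }
  assert (Hgu : hol (fun z => g z - u) 0 (3 * r)).
  { apply hol_intro; intros z Hz; eexists; now apply Dg. }
  destruct (Cexp_surj (g 0 - u)) as [l Hl]; [now apply Nz|].
  assert (HL := hol_log (fun z => g z - u) 0 (3 * r) l Hgu Nz Hl).
  set (h := fun z => l + C_int (fun w => C_derive (fun z => g z - u) w / (g w - u)) 0 z).
  assert (Eh : forall z, odisc 0 (3 * r) z -> Cexp (h z) = g z - u) by (intros z Hz; now apply HL).
  assert (Hh : hol h 0 (3 * r)).
  { apply hol_intro; intros z Hz; eexists; now apply HL. }
  assert (Om : forall w, exists v, Cmod (v - w) <= 4 /\ forall z, odisc 0 (3 * r) z -> h z <> v).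
  (* An omitted v at distance e^{Re w} from u has logarithms of v - u with real part exactly Re w,
     and one of them has imaginary part within 4 of Im w. *)
  { intros w; destruct (Hv (exp (Re w)) (exp_pos _)) as [v [V1 V2]].
    destruct (Cexp_surj (v - u)) as [y Hy].
    { intros K; rewrite K, Cmod_0 in V1; assert (P := exp_pos (Re w)); lra. }
    rewrite <- Hy, Cmod_Cexp in V1; apply exp_inv in V1.
    destruct (nearest_mod_2PI (Im y) (Im w)) as [k Hk].
    exists (y + Ci * RtoC (2 * PI * IZR k)); split.
    - replace (y + Ci * RtoC (2 * PI * IZR k) - w) with (0, Im y + 2 * PI * IZR k - Im w)%R.
      + eapply Rle_trans; [apply Cmod_le_abs|]; rewrite Rabs_R0; lra.
      + destruct y as [y1 y2], w as [w1 w2]; simpl in V1; subst y1.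
        apply injective_projections; simpl; ring.
    - intros z Hz K; apply (V2 z Hz).
      assert (E := Eh z Hz); rewrite K, Cexp_2PI_Z, Hy in E.
      replace (g z) with (g z - u + u) by ring; rewrite <- E; ring. }
  (* With s = 2r the factor s - |z| is at least r on |z| <= r, so h is Lipschitz there with constant
     1024 / r and varies from h(0) by at most 1024. *)
  assert (B := bloch h (3 * r) (2 * r) ltac:(lra) Hh Om).
  intros z Hz.
  assert (P := Cmod_ge_0 z).
  assert (Din : forall z, Cmod z <= r -> odisc 0 (3 * r) z) by (intros w Hw; unfold odisc; rewrite Z0; lra).
  assert (V : Cmod (h z - h 0 - 0 * (z - 0)) <= 1024 / r * Cmod (z - 0)).
  { apply (mean_value_ineq (cdisc 0 r) h (C_derive h)); unfold cdisc.
    - apply cdisc_convex.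
    - intros w Hw; rewrite Z0 in Hw; now apply Hh, Din.
    - intros w Hw; rewrite Z0 in Hw; apply (hol_cont _ 0 (3 * r)); [now apply hol_C_derive|now apply Din].
    - intros w Hw; rewrite Z0 in *; apply Rle_div_r; [lra|].
      specialize (B w ltac:(lra)); assert (Q := Cmod_ge_0 (C_derive h w)); nra.
    - rewrite Z0, Cmod_0; lra.
    - now rewrite Z0. }
  rewrite Z0 in V; replace (h z - h 0 - 0 * z) with (h z - h 0) in V by ring.
  assert (V' : Cmod (h z - h 0) <= 1024).
  { eapply Rle_trans; [exact V|]; replace 1024%R with (1024 / r * r)%R at 2 by (field; lra).
    apply Rmult_le_compat_l; [|auto]; apply Rlt_le, Rdiv_lt_0_compat; lra. }
  rewrite <- !Eh by auto; rewrite !Cmod_Cexp, <- exp_plus.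
  assert (Q := re_le_Cmod (h z - h 0)); rewrite Re_minus in Q.
  apply Rabs_le_between in Q.
  destruct (Rle_lt_or_eq_dec (Re (h z)) (1024 + Re (h 0))) as [K|K]; [lra| |].
  - left; now apply exp_increasing.
  - rewrite K; lra.
Qed.

(* A form of Polya's growth theorem for composites. If |F(G z)| <= K on
   |z| < 3r and |F(u)| > K, then the image of G contains neither u nor, by the
   maximum principle for F, any full circle centred at u. *)
Lemma composition_growth F G a : entire F -> entire G -> C_derive F a <> 0 ->
  exists C0, 0 < C0 /\ forall K r, 1 <= K -> 0 < r ->
    (forall z, Cmod z < 3 * r -> Cmod (F (G z)) <= K) ->
    forall z, Cmod z <= r -> Cmod (G z) <= C0 * K.
Proof.
  intros HF HG Ha.
  assert (Z0 : forall z : C, z - 0 = z) by (intros; ring).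
  apply Cmod_gt_0 in Ha; set (d := Cmod (C_derive F a)) in *.
  assert (Pe := exp_pos 1024); assert (Ga := Cmod_ge_0 a); assert (G0 := Cmod_ge_0 (G 0)).
  assert (Pd : 0 < 2 / d) by (apply Rdiv_lt_0_compat; lra).
  (* From |G z| <= |u| + e^1024 (|G 0| + |u|), |u| <= (|a| + 2/d) K and K >= 1. *)
  exists ((1 + exp 1024) * (Cmod a + 2 / d) + exp 1024 * Cmod (G 0))%R; split; [nra|].
  intros K r HK Hr Hb z Hz.
  (* If |F| <= K on the circle of radius 2K/d about a, Cauchy's estimate gives d <= d/2. *)
  assert (Hu : exists u, Cmod (u - a) = (2 / d * K)%R /\ K < Cmod (F u)).
  { apply NNPP; intros N.
    assert (B : d <= K / (2 / d * K)).
    { apply (cauchy_estimate F a (2 / d * K) (2 / d * K + 1)); [nra|now apply entire_hol|].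
      intros u Hu; apply Rnot_lt_le; intros L; apply N; now exists u. }
    replace (K / (2 / d * K))%R with (d / 2)%R in B by (field; lra); lra. }
  destruct Hu as [u [U1 U2]].
  assert (Hg : Cmod (G z - u) <= exp 1024 * Cmod (G 0 - u)).
  { apply (growth_of_omitting G u r); auto.
    - now apply entire_hol.
    - intros w Hw E; unfold odisc in Hw; rewrite Z0 in Hw; specialize (Hb w Hw).
      rewrite E in Hb; lra.
    - intros rho Hrho; apply NNPP; intros N.
      assert (B : Cmod (F u) <= K).
      { apply (max_modulus F u rho (rho + 1)); [lra|now apply entire_hol|].
        intros v Hv; apply Rnot_lt_le; intros L; apply N; exists v; split; auto.
        intros w Hw E; unfold odisc in Hw; rewrite Z0 in Hw; specialize (Hb w Hw).
        rewrite E in Hb; lra. }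
      lra. }
  assert (Bu : Cmod u <= (Cmod a + 2 / d) * K).
  { assert (A := Cmod_rtriangle u a); nra. }
  assert (A1 := Cmod_rtriangle (G z) u).
  assert (A2 : Cmod (G 0 - u) <= Cmod (G 0) + Cmod u).
  { unfold Cminus; eapply Rle_trans; [apply Cmod_triangle|]; rewrite Cmod_opp; lra. }
  assert (A3 : exp 1024 * Cmod (G 0 - u) <= exp 1024 * (Cmod (G 0) * K + (Cmod a + 2 / d) * K))
    by (apply Rmult_le_compat_l; nra).
  nra.
Qed.

(** * Entire functions of polynomial growth *)

(** The base 1 + |z| is at least 1, so its powers increase with n and bounds of different degrees
    can be merged. *)
Definition poly_growth (s : C -> C) : Prop :=
  exists C0 (n : nat), 0 < C0 /\ forall z, Cmod (s z) <= C0 * (1 + Cmod z) ^ n.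

Lemma one_le_growth z n : 1 <= (1 + Cmod z) ^ n.
Proof. apply pow_R1_Rle; assert (P := Cmod_ge_0 z); lra. Qed.

Lemma pow_le_growth z m n : (m <= n)%nat -> (1 + Cmod z) ^ m <= (1 + Cmod z) ^ n.
Proof. intros H; apply Rle_pow; auto; assert (P := Cmod_ge_0 z); lra. Qed.

Lemma poly_growth_const c : poly_growth (fun _ => c).
Proof.
  exists (Cmod c + 1)%R, 0%nat; assert (P := Cmod_ge_0 c); split; [lra|].
  intros z; simpl; lra.
Qed.

Lemma poly_growth_id : poly_growth (fun z => z).
Proof. exists 1%R, 1%nat; split; [lra|]; intros z; assert (P := Cmod_ge_0 z); simpl; lra. Qed.

Lemma poly_growth_plus f g : poly_growth f -> poly_growth g -> poly_growth (fun z => f z + g z).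
Proof.
  intros [C1 [n [H1 B1]]] [C2 [m [H2 B2]]].
  exists (C1 + C2)%R, (n + m)%nat; split; [lra|]; intros z.
  eapply Rle_trans; [apply Cmod_triangle|].
  assert (E1 := pow_le_growth z n (n + m) ltac:(lia)).
  assert (E2 := pow_le_growth z m (n + m) ltac:(lia)).
  specialize (B1 z); specialize (B2 z); nra.
Qed.

Lemma poly_growth_mult f g : poly_growth f -> poly_growth g -> poly_growth (fun z => f z * g z).
Proof.
  intros [C1 [n [H1 B1]]] [C2 [m [H2 B2]]].
  exists (C1 * C2)%R, (n + m)%nat; split; [nra|]; intros z.
  rewrite Cmod_mult, pow_add.
  replace (C1 * C2 * ((1 + Cmod z) ^ n * (1 + Cmod z) ^ m))%R with
    ((C1 * (1 + Cmod z) ^ n) * (C2 * (1 + Cmod z) ^ m))%R by ring.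
  apply Rmult_le_compat; auto; apply Cmod_ge_0.
Qed.

Lemma poly_growth_ext f g : (forall z, f z = g z) -> poly_growth f -> poly_growth g.
Proof.
  intros E [C1 [n [H1 B1]]]; exists C1, n; split; auto; intros z; now rewrite <- E.
Qed.

Lemma poly_growth_derive f : entire f -> poly_growth f -> poly_growth (C_derive f).
Proof.
  intros Hf [C1 [n [H1 B1]]]; exists (C1 * 2 ^ n)%R, n.
  assert (P2 : 0 < 2 ^ n) by (apply pow_lt; lra); split; [nra|]; intros z.
  assert (P := Cmod_ge_0 z).
  assert (E := cauchy_estimate f z 1 2 (C1 * 2 ^ n * (1 + Cmod z) ^ n) ltac:(lra) (entire_hol f z 2 Hf)).
  rewrite Rdiv_1_r in E; apply E; intros w Hw.
  eapply Rle_trans; [apply B1|]; rewrite Rmult_assoc; apply Rmult_le_compat_l; [lra|].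
  rewrite <- Rpow_mult_distr; apply pow_incr.
  assert (A := Cmod_rtriangle w z); assert (P' := Cmod_ge_0 w); lra.
Qed.

Lemma poly_growth_of_Re h : entire h ->
  (exists C0 (n : nat), 0 < C0 /\ forall z, Re (h z) <= C0 * (1 + Cmod z) ^ n) -> poly_growth h.
Proof.
  intros Hh [C0 [n [H0 B]]].
  set (b := Rabs (Re (h 0))); assert (Hb : 0 <= b) by apply Rabs_pos.
  set (e := (2 * exp 2)%R); assert (He : 0 < e) by (assert (P := exp_pos 2); unfold e; lra).
  assert (P4 : 1 <= 4 ^ n) by (apply pow_R1_Rle; lra).
  assert (Hc := Cmod_ge_0 (h 0)).
  assert (H4 : 0 < C0 * 4 ^ n + 1 + b) by nra.
  exists (Cmod (h 0) + e * (C0 * 4 ^ n + 1 + b))%R, n; split; [nra|]; intros z.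
  assert (P := Cmod_ge_0 z).
  (* With this radius 1 + |w| <= 4r on |w| < 3r; the 1 added to the bound supplies the strict
     inequality in [borel_caratheodory]. *)
  set (r := (1 + Cmod z)%R).
  assert (K := borel_caratheodory h r (C0 * 4 ^ n * r ^ n + 1) ltac:(unfold r; lra)
    (entire_hol h 0 (3 * r) Hh)).
  assert (V : Cmod (h z - h 0) <= e * (C0 * 4 ^ n * r ^ n + 1 - Re (h 0))).
  { apply K; [|unfold r; lra]; intros w Hw; unfold odisc in Hw; replace (w - 0) with w in Hw by ring.
    eapply Rle_lt_trans; [apply B|].
    assert ((1 + Cmod w) ^ n <= (4 * r) ^ n).
    { apply pow_incr; assert (P' := Cmod_ge_0 w); unfold r in *; lra. }
    rewrite Rpow_mult_distr in H; nra. }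
  assert (A := Cmod_rtriangle (h z) (h 0)).
  assert (R0 : - Re (h 0) <= b) by (unfold b; rewrite <- Rabs_Ropp; apply RRle_abs).
  assert (R1 := one_le_growth z n); fold r in R1 |- *.
  assert (e * (C0 * 4 ^ n * r ^ n + 1 - Re (h 0)) <= e * ((C0 * 4 ^ n + 1 + b) * r ^ n)).
  { apply Rmult_le_compat_l; nra. }
  nra.
Qed.

(** Used with x = |h'(a)| to conclude that a logarithm growing slower than any power has derivative
    zero. *)
Lemma quadratic_domination (x K L b T0 : R) : 0 <= x ->
  (forall T, T0 <= T -> x * (T * T - b) <= K + L * T) -> x = 0%R.
Proof.
  intros Hx H; destruct (Rle_lt_or_eq_dec _ _ Hx) as [P|P]; auto; exfalso.
  set (S := (Rabs K + Rabs L + x * Rabs b + 1)%R).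
  assert (A1 := Rabs_pos K); assert (A2 := Rabs_pos L); assert (A3 := Rabs_pos b).
  assert (A4 := Rabs_pos T0).
  assert (B1 := RRle_abs K); assert (B2 := RRle_abs L); assert (B3 := RRle_abs b).
  assert (B4 := RRle_abs T0).
  assert (HS : 0 < S) by (unfold S; nra).
  (* Beyond T0 and with x T >= S, so x T^2 >= S T, while S exceeds the sum of the coefficients on
     the other side. *)
  set (T := (1 + Rabs T0 + S / x)%R).
  assert (Q : 0 < S / x) by now apply Rdiv_lt_0_compat.
  assert (E : (x * (S / x) = S)%R) by (field; lra).
  specialize (H T ltac:(unfold T; lra)).
  assert (T1 : 1 <= T) by (unfold T; lra).
  assert (T2 : S <= x * T) by (unfold T; nra).
  assert (T3 : S * T <= x * T * T) by (apply Rmult_le_compat_r; lra).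
  assert (T4 : K + L * T + x * b < S * T).
  { unfold S; assert (x * b <= x * Rabs b) by nra.
    assert (L * T <= Rabs L * T) by nra. assert (Rabs K <= Rabs K * T) by nra.
    assert (x * Rabs b <= x * Rabs b * T) by (assert (0 <= x * Rabs b) by nra; nra).
    nra. }
  nra.
Qed.

Lemma ln_le_self x : 0 < x -> ln x <= x.
Proof.
  intros H; assert (A := exp_ineq1_le (ln x)); rewrite exp_ln in A; lra.
Qed.

Lemma ln_le_mono x y : 0 < x -> x <= y -> ln x <= ln y.
Proof. intros H [L| ->]; [left; now apply ln_increasing|lra]. Qed.

Lemma derive_0_const s : entire s -> (forall z, C_derive s z = 0) -> forall z w, s z = s w.
Proof.
  intros Hs H z w; apply (zero_derivative_const (fun _ => True)); auto.
  - intros a b t _ _ _; exact I.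
  - intros x _; rewrite <- (H x); now apply entire_der.
Qed.

(* Such an s is e^h with Re h = O(log |z|); this is also how the fundamental
   theorem of algebra enters. *)
Lemma nonvanishing_poly_growth_const s : entire s -> (forall z, s z <> 0) -> poly_growth s ->
  forall z w, s z = s w.
Proof.
  intros Hs Hn [C0 [n [H0 B]]].
  destruct (entire_log s Hs Hn) as [h [Hh Eh]].
  assert (L : forall z, Re (h z) <= ln C0 + INR n * ln (1 + Cmod z)).
  { intros z; assert (P := Cmod_ge_0 z).
    rewrite <- (ln_exp (Re (h z))), <- Cmod_Cexp, <- Eh, <- ln_pow, <- ln_mult
      by (try apply pow_lt; lra).
    apply ln_le_mono; [|apply B]; apply Cmod_gt_0, Hn. }
  assert (D : forall a, C_derive h a = 0).
  { intros a; apply Cmod_eq_0.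
    assert (Pa := Cmod_ge_0 a); assert (Pn := pos_INR n).
    (* With 2r = T^2 - (1 + |a|), every z in the disc of radius 2r about a has 1 + |z| < T^2, so ln
       (1 + |z|) <= 2 ln T <= 2T. The derivative estimate at radius r is then linear in T against r
       of order T^2. *)
    apply (quadratic_domination _ (4 * (ln C0 + 1 - Re (h a))) (8 * INR n)
      (1 + Cmod a) (2 + Cmod a)); [apply Cmod_ge_0|].
    intros T HT; set (r := ((T * T - (1 + Cmod a)) / 2)%R).
    assert (Hr : 0 < r) by (unfold r; nra).
    assert (A := borel_caratheodory_derivative h a (2 * r) r (ln C0 + 2 * INR n * T + 1)
      ltac:(lra) (entire_hol h a (2 * r) Hh)).
    assert (A' : Cmod (C_derive h a) <= 2 * (ln C0 + 2 * INR n * T + 1 - Re (h a)) / r).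
    { apply A; intros z Hz; unfold odisc in Hz.
      assert (Q := Cmod_rtriangle z a); assert (Pz := Cmod_ge_0 z).
      assert (M : ln (1 + Cmod z) <= 2 * T).
      { apply (Rle_trans _ (ln (T * T))); [apply ln_le_mono; unfold r in *; lra|].
        rewrite ln_mult by lra; assert (W := ln_le_self T ltac:(lra)); lra. }
      specialize (L z); nra. }
    apply Rle_div_r in A'; [|auto]; unfold r in A'.
    assert (Pc := Cmod_ge_0 (C_derive h a)); lra. }
  intros z w; rewrite !Eh; f_equal; now apply derive_0_const.
Qed.

(** * Polynomials *)

Lemma entire_intro f f' : (forall z, Cder f z (f' z)) -> entire f.
Proof. intros H; apply entire_Cder; intros z; now exists (f' z). Qed.

Lemma entire_Cpoly_eval p : entire (Cpoly_eval p).
Proof.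
  apply entire_Cder; induction p as [|a p IH]; intros z.
  - exists 0; apply Cder_const.
  - destruct (IH z) as [l Hl]; eexists.
    apply (Cder_plus (fun _ => a) (fun t => t * Cpoly_eval p t)); [apply Cder_const|].
    apply Cder_mult; [apply Cder_id|exact Hl].
Qed.

Lemma poly_growth_Cpoly_eval p : poly_growth (Cpoly_eval p).
Proof.
  induction p as [|a p IH].
  - apply poly_growth_const.
  - apply (poly_growth_plus (fun _ => a) (fun t => t * Cpoly_eval p t)).
    + apply poly_growth_const.
    + apply poly_growth_mult; [apply poly_growth_id|exact IH].
Qed.

(** The quotient of p by t - x, by Horner's scheme. *)
Fixpoint Cpoly_quot (p : list C) (x : C) : list C :=
  match p with
  | nil => nil
  | a :: q => match q with nil => nil | _ => Cpoly_eval q x :: Cpoly_quot q x end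
  end.

Lemma Cpoly_eval_cons a q z : Cpoly_eval (a :: q) z = a + z * Cpoly_eval q z.
Proof. reflexivity. Qed.

Lemma Cpoly_quot_spec p x z :
  Cpoly_eval p z = Cpoly_eval p x + (z - x) * Cpoly_eval (Cpoly_quot p x) z.
Proof.
  induction p as [|a q IH]; [simpl; ring|].
  destruct q as [|b q']; [simpl; ring|]; set (q := b :: q') in *.
  change (Cpoly_quot (a :: q) x) with (Cpoly_eval q x :: Cpoly_quot q x).
  rewrite !Cpoly_eval_cons, IH; ring.
Qed.

Lemma length_Cpoly_quot a q x : length (Cpoly_quot (a :: q) x) = length q.
Proof.
  revert a; induction q as [|b q IH]; intros a; [reflexivity|].
  change (S (length (Cpoly_quot (b :: q) x)) = S (length q)); now rewrite IH.
Qed.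

(** Induction on the length of the coefficient list, dividing by t - x(0); the degree is unsuitable
    because trailing zeros are allowed. *)
Lemma Cpoly_infinitely_many_roots p (x : nat -> C) : (forall i j, x i = x j -> i = j) ->
  (forall k, Cpoly_eval p (x k) = 0) -> forall z, Cpoly_eval p z = 0.
Proof.
  remember (length p) as n eqn:Hn; revert p x Hn; induction n as [|n IH]; intros p x Hn Hx Hr z.
  - destruct p; [reflexivity|discriminate].
  - destruct p as [|a q]; [discriminate|]; injection Hn as Hn.
    rewrite (Cpoly_quot_spec _ (x 0%nat)), Hr.
    rewrite (IH (Cpoly_quot (a :: q) (x 0%nat)) (fun k => x (S k))); [ring| | |].
    + now rewrite length_Cpoly_quot.
    + intros i j E; apply Hx in E; lia.
    + intros k; assert (Hk := Hr (S k)); rewrite (Cpoly_quot_spec _ (x 0%nat)), (Hr 0%nat) in Hk.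
      apply NNPP; intros N; apply (Cmult_neq_0 (x (S k) - x 0%nat)
        (Cpoly_eval (Cpoly_quot (a :: q) (x 0%nat)) (x (S k)))); auto.
      * apply Cminus_eq_contra; intros E; apply Hx in E; discriminate.
      * rewrite <- Hk; ring.
Qed.

Lemma Ccont_zero_off_0 g : Ccont g 0 -> (forall t : C, t <> 0 -> g t = 0) -> g 0 = 0.
Proof.
  intros Hg H; apply Cmod_0_eq; intros e He; destruct (Hg e He) as [d [Hd Hd']].
  assert (Pd : RtoC (d / 2) <> 0) by (intros K; apply RtoC_inj in K; lra).
  specialize (Hd' (RtoC (d / 2))); rewrite (H _ Pd) in Hd'.
  replace (RtoC (d / 2) - 0) with (RtoC (d / 2)) in Hd' by ring.
  rewrite Cmod_R, Rabs_pos_eq in Hd' by lra.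
  replace (0 - g 0) with (- g 0) in Hd' by ring; rewrite Cmod_opp in Hd'.
  left; apply Hd'; lra.
Qed.

(** Off 0 the factor z cancels; at 0 the value follows by continuity. *)
Lemma Cpoly_eval_tail_zero a q : (forall z, Cpoly_eval (a :: q) z = a) ->
  forall z, Cpoly_eval q z = 0.
Proof.
  intros H.
  assert (N : forall z : C, z <> 0 -> Cpoly_eval q z = 0).
  { intros z Hz; specialize (H z); rewrite Cpoly_eval_cons in H.
    assert (E : z * Cpoly_eval q z = 0).
    { replace (z * Cpoly_eval q z) with (a + z * Cpoly_eval q z - a) by ring; rewrite H; ring. }
    destruct (classic (Cpoly_eval q z = 0)) as [K|K]; auto.
    exfalso; exact (Cmult_neq_0 _ _ Hz K E). }
  intros z; destruct (classic (z = 0)) as [->|n]; auto.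
  apply Ccont_zero_off_0; auto.
  eapply Cder_cont, entire_der, entire_Cpoly_eval.
Qed.

Lemma Cpoly_eval_zero p : (forall z, Cpoly_eval p z = 0) -> forall k, nth k p (RtoC 0) = 0.
Proof.
  induction p as [|a q IH]; intros H k; [now destruct k|].
  assert (Ha : a = 0).
  { rewrite <- (H 0), Cpoly_eval_cons; ring. }
  destruct k as [|k]; [exact Ha|]; apply IH.
  apply (Cpoly_eval_tail_zero a); intros z; now rewrite H, Ha.
Qed.

Lemma Cpoly_nonconstant_spec p : Cpoly_nonconstant p ->
  exists z, Cpoly_eval p z <> Cpoly_eval p 0.
Proof.
  intros [k [Hk Hn]]; apply NNPP; intros N; apply Hn.
  destruct p as [|a q]; [now destruct k|]; destruct k as [|k]; [lia|].
  simpl; apply Cpoly_eval_zero, (Cpoly_eval_tail_zero a); intros z.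
  apply NNPP; intros M; apply N; exists z; intros E; apply M.
  rewrite E, Cpoly_eval_cons; ring.
Qed.

(** The difference of the two sides is a polynomial vanishing at every multiple k tau. *)
Lemma Cpoly_translation_linear p (tau delta : C) : tau <> 0 ->
  (forall z, Cpoly_eval p (z + tau) = Cpoly_eval p z + delta) ->
  forall z, Cpoly_eval p z = Cpoly_eval p 0 + delta / tau * z.
Proof.
  intros Ht H.
  assert (E : forall k, Cpoly_eval p (RtoC (INR k) * tau) = Cpoly_eval p 0 + RtoC (INR k) * delta).
  { induction k as [|k IH].
    - simpl; replace (0 * tau) with (RtoC 0) by ring; ring.
    - rewrite S_INR, RtoC_plus.
      replace ((RtoC (INR k) + 1) * tau) with (RtoC (INR k) * tau + tau) by ring.
      rewrite H, IH; ring. }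
  assert (Q : exists q, forall z, Cpoly_eval q z = Cpoly_eval p z - Cpoly_eval p 0 - delta / tau * z).
  { destruct p as [|a [|b r]].
    - exists (RtoC 0 :: - (delta / tau) :: nil); intros z; simpl; ring.
    - exists (RtoC 0 :: - (delta / tau) :: nil); intros z; simpl; ring.
    - exists (RtoC 0 :: (b - delta / tau) :: r); intros z; simpl; ring. }
  destruct Q as [q Hq].
  intros z; assert (R := Cpoly_infinitely_many_roots q (fun k => RtoC (INR k) * tau)).
  assert (Z : Cpoly_eval q z = 0).
  { apply R.
    - intros i j K; apply INR_eq, RtoC_inj.
      transitivity (RtoC (INR i) * tau / tau); [field; auto|]; rewrite K; field; auto.
    - intros k; rewrite Hq, E; field; auto. }
  rewrite Hq in Z.
  replace (Cpoly_eval p z) with (Cpoly_eval p z - Cpoly_eval p 0 - delta / tau * z +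
    (Cpoly_eval p 0 + delta / tau * z)) by ring.
  rewrite Z; ring.
Qed.

Lemma Cexp_const_inv u c : entire u -> (forall z, Cexp (u z) = c) -> forall z w, u z = u w.
Proof.
  intros Hu H; apply derive_0_const; auto; intros z.
  assert (D1 : Cder (fun z => Cexp (u z)) z (Cexp (u z) * C_derive u z)).
  { apply Cder_comp; [now apply entire_der|apply Cder_Cexp]. }
  assert (D2 : Cder (fun z => Cexp (u z)) z 0).
  { apply (Cder_ext (fun _ => c)); [auto|apply Cder_const]. }
  assert (E := Cder_unique _ _ _ _ D1 D2).
  destruct (classic (C_derive u z = 0)) as [K|K]; auto.
  exfalso; exact (Cmult_neq_0 _ _ (Cexp_neq_0 (u z)) K E).
Qed.

Lemma affine_of_const_derivative G (al : C) : entire G -> al <> 0 -> (forall z, C_derive G z = al) ->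
  is_affine G.
Proof.
  intros HG Hal HD; exists al, (G 0); split; auto; intros z.
  assert (E : G z - al * z = G 0 - al * 0).
  { apply (zero_derivative_const (fun _ => True) (fun z => G z - al * z)); auto.
    - intros a b t _ _ _; exact I.
    - intros w _; eapply Cder_eq.
      + apply Cder_minus; [now apply entire_der|apply Cder_scal, Cder_id].
      + rewrite HD; ring. }
  replace (G z) with (G z - al * z + al * z) by ring; rewrite E; ring.
Qed.

Lemma affine_of_poly_growth G : entire G -> (forall z, C_derive G z <> 0) -> poly_growth G ->
  is_affine G.
Proof.
  intros HG Hn Hp; apply (affine_of_const_derivative G (C_derive G 0)); auto.
  intros z; apply nonvanishing_poly_growth_const; auto.
  - now apply entire_C_derive.
  - now apply poly_growth_derive.
Qed.

(** * Exponential growth *)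

(** Finite order of growth. *)
Definition exp_growth (s : C -> C) : Prop :=
  exists C0 (n : nat), 0 < C0 /\ forall z, Cmod (s z) <= exp (C0 * (1 + Cmod z) ^ n).

Lemma exp_le_mono x y : x <= y -> exp x <= exp y.
Proof. intros [L| ->]; [left; now apply exp_increasing|lra]. Qed.

(** A constant factor is absorbed in the exponent because c <= e^c. *)
Lemma exp_mult_growth c X C0 z n : 0 <= c -> X <= exp (C0 * (1 + Cmod z) ^ n) ->
  c * X <= exp ((C0 + c) * (1 + Cmod z) ^ n).
Proof.
  intros Hc HX; rewrite Rmult_plus_distr_r, exp_plus, Rmult_comm.
  assert (P := exp_pos (C0 * (1 + Cmod z) ^ n)); assert (O := one_le_growth z n).
  assert (E := exp_ineq1_le (c * (1 + Cmod z) ^ n)).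
  apply (Rle_trans _ (exp (C0 * (1 + Cmod z) ^ n) * c)); [nra|].
  apply Rmult_le_compat_l; nra.
Qed.

Lemma exp_growth_shift C0 z w n k : 0 < C0 -> 0 <= k -> 1 + Cmod w <= k * (1 + Cmod z) ->
  exp (C0 * (1 + Cmod w) ^ n) <= exp (C0 * k ^ n * (1 + Cmod z) ^ n).
Proof.
  intros H0 Hk H; apply exp_le_mono; rewrite Rmult_assoc, <- Rpow_mult_distr.
  apply Rmult_le_compat_l; [lra|]; apply pow_incr; assert (P := Cmod_ge_0 w); lra.
Qed.

Lemma exp_growth_derive f : entire f -> exp_growth f -> exp_growth (C_derive f).
Proof.
  intros Hf [C1 [n [H1 B1]]]; exists (C1 * 2 ^ n)%R, n.
  assert (P2 : 0 < 2 ^ n) by (apply pow_lt; lra); split; [nra|]; intros z.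
  assert (P := Cmod_ge_0 z).
  assert (E := cauchy_estimate f z 1 2 (exp (C1 * 2 ^ n * (1 + Cmod z) ^ n)) ltac:(lra) (entire_hol f z 2 Hf)).
  rewrite Rdiv_1_r in E; apply E; intros w Hw.
  eapply Rle_trans; [apply B1|]; apply exp_growth_shift; auto; [lra|].
  assert (A := Cmod_rtriangle w z); lra.
Qed.

Lemma exp_growth_minus_const f c : exp_growth f -> exp_growth (fun z => f z - c).
Proof.
  intros [C1 [n [H1 B1]]]; assert (Pc := Cmod_ge_0 c).
  exists (C1 + (1 + Cmod c))%R, n; split; [lra|]; intros z.
  assert (P : 1 <= exp (C1 * (1 + Cmod z) ^ n)).
  { rewrite <- exp_0 at 1; apply exp_le_mono; assert (O := one_le_growth z n); apply Rmult_le_pos; lra. }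
  eapply Rle_trans; [|apply (exp_mult_growth (1 + Cmod c) (exp (C1 * (1 + Cmod z) ^ n))); lra].
  unfold Cminus; eapply Rle_trans; [apply Cmod_triangle|]; rewrite Cmod_opp.
  specialize (B1 z); nra.
Qed.

Lemma exp_growth_ext f g : (forall z, f z = g z) -> exp_growth f -> exp_growth g.
Proof.
  intros E [C1 [n [H1 B1]]]; exists C1, n; split; auto; intros z; now rewrite <- E.
Qed.

Lemma poly_growth_log h : entire h -> exp_growth (fun z => Cexp (h z)) -> poly_growth h.
Proof.
  intros Hh [C1 [n [H1 B1]]]; apply poly_growth_of_Re; auto.
  exists C1, n; split; auto; intros z; specialize (B1 z); rewrite Cmod_Cexp in B1.
  destruct (Rle_lt_dec (Re (h z)) (C1 * (1 + Cmod z) ^ n)) as [L|L]; auto.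
  apply exp_increasing in L; lra.
Qed.

Lemma exp_growth_Cexp h : poly_growth h -> exp_growth (fun z => Cexp (h z)).
Proof.
  intros [C1 [n [H1 B1]]]; exists C1, n; split; auto; intros z.
  rewrite Cmod_Cexp; apply exp_le_mono; specialize (B1 z).
  assert (A := re_le_Cmod (h z)); assert (A' := RRle_abs (Re (h z))); lra.
Qed.

Lemma exp_growth_primitive f f' : (forall z, Cder f z (f' z)) -> f 0 = 0 -> exp_growth f' ->
  exp_growth f.
Proof.
  intros Hf F0 [C1 [n [H1 B1]]]; assert (He := entire_intro f f' Hf).
  exists (C1 + 1)%R, (S n); split; [lra|]; intros z.
  assert (P := Cmod_ge_0 z); assert (O := one_le_growth z n).
  assert (V : Cmod (f z - f 0 - 0 * (z - 0)) <= exp (C1 * (1 + Cmod z) ^ n) * Cmod (z - 0)).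
  { apply (mean_value_ineq (cdisc 0 (Cmod z)) f f'); auto.
    - apply cdisc_convex.
    (* f' coincides with [C_derive f], which is entire and so continuous. *)
    - intros w _; apply (Cder_cont _ _ (C_derive (C_derive f) w)).
      apply (Cder_ext (C_derive f)); [intros; now apply C_derive_Cder|].
      now apply entire_der, entire_C_derive.
    - intros w Hw; unfold cdisc in Hw; replace (w - 0) with w in Hw by ring.
      replace (f' w - 0) with (f' w) by ring; eapply Rle_trans; [apply B1|].
      apply exp_le_mono, Rmult_le_compat_l; [lra|]; apply pow_incr.
      assert (P' := Cmod_ge_0 w); lra.
    - unfold cdisc; replace (RtoC 0 - 0) with (RtoC 0) by ring; now rewrite Cmod_0.
    - unfold cdisc; replace (z - 0) with z by ring; lra. }
  rewrite F0 in V; replace (f z - 0 - 0 * (z - 0)) with (f z) in V by ring.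
  replace (z - 0) with z in V by ring.
  eapply Rle_trans; [exact V|].
  assert (E : Cmod z <= exp (Cmod z)) by (assert (A := exp_ineq1_le (Cmod z)); lra).
  apply (Rle_trans _ (exp (C1 * (1 + Cmod z) ^ n) * exp (Cmod z))).
  { apply Rmult_le_compat_l; [left; apply exp_pos|auto]. }
  rewrite <- exp_plus; apply exp_le_mono; simpl.
  assert ((1 + Cmod z) ^ n <= (1 + Cmod z) * (1 + Cmod z) ^ n) by nra.
  nra.
Qed.

(** [composition_growth] is applied with radius 1 + |z|: on three times that radius 1 + |w| <= 4 (1
    + |z|), whence 4^n. *)
Lemma exp_growth_right_factor F G a : entire F -> entire G -> C_derive F a <> 0 ->
  exp_growth (fun z => F (G z)) -> exp_growth G.
Proof.
  intros HF HG Ha [C1 [n [H1 B1]]].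
  destruct (composition_growth F G a HF HG Ha) as [C0 [H0 B0]].
  exists (C1 * 4 ^ n + C0)%R, n.
  assert (P4 : 0 < 4 ^ n) by (apply pow_lt; lra); split; [nra|]; intros z.
  assert (P := Cmod_ge_0 z); assert (O := one_le_growth z n).
  eapply Rle_trans; [|apply exp_mult_growth; [lra|apply Rle_refl]].
  apply (B0 _ (1 + Cmod z)%R); [|lra| |lra].
  - rewrite <- exp_0 at 1; apply exp_le_mono; apply Rmult_le_pos; nra.
  - intros w Hw; eapply Rle_trans; [apply B1|]; apply exp_growth_shift; lra.
Qed.

Lemma poly_growth_right_factor F G a : entire F -> entire G -> C_derive F a <> 0 ->
  poly_growth (fun z => F (G z)) -> poly_growth G.
Proof.
  intros HF HG Ha [C1 [n [H1 B1]]].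
  destruct (composition_growth F G a HF HG Ha) as [C0 [H0 B0]].
  assert (P4 : 0 < 4 ^ n) by (apply pow_lt; lra).
  (* The added 1 makes the bound K on F o G at least 1. *)
  exists (C0 * (C1 * 4 ^ n + 1))%R, n; split; [assert (0 < C1 * 4 ^ n) by nra; nra|]; intros z.
  assert (P := Cmod_ge_0 z); assert (O := one_le_growth z n).
  rewrite Rmult_assoc; apply (B0 _ (1 + Cmod z)%R); [assert (0 < C1 * 4 ^ n) by nra; nra|lra| |lra].
  intros w Hw; eapply Rle_trans; [apply B1|].
  apply (Rle_trans _ (C1 * (4 * (1 + Cmod z)) ^ n)).
  - apply Rmult_le_compat_l; [lra|]; apply pow_incr; assert (P' := Cmod_ge_0 w); lra.
  - rewrite Rpow_mult_distr; nra.
Qed.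

Lemma entire_minus f g : entire f -> entire g -> entire (fun z => f z - g z).
Proof.
  intros Hf Hg; apply (entire_intro _ (fun z => C_derive f z - C_derive g z)); intros z.
  now apply Cder_minus; apply entire_der.
Qed.

Lemma entire_plus f g : entire f -> entire g -> entire (fun z => f z + g z).
Proof.
  intros Hf Hg; apply (entire_intro _ (fun z => C_derive f z + C_derive g z)); intros z.
  now apply Cder_plus; apply entire_der.
Qed.

Lemma entire_comp f g : entire f -> entire g -> entire (fun z => f (g z)).
Proof.
  intros Hf Hg; apply (entire_intro _ (fun z => C_derive f (g z) * C_derive g z)); intros z.
  now apply Cder_comp; apply entire_der.
Qed.

Lemma entire_const c : entire (fun _ => c).
Proof. apply (entire_intro _ (fun _ => 0)); intros z; apply Cder_const. Qed.

Lemma entire_Cexp : entire Cexp.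
Proof. apply (entire_intro _ Cexp), Cder_Cexp. Qed.

Lemma omitting_composite f w : elh f -> (forall z, f z <> w) -> composite f.
Proof.
  intros Hf Hw; split; auto; destruct Hf as [Hf _].
  destruct (entire_log (fun z => f z - w)) as [h [Hh Eh]].
  - apply entire_minus; [auto|apply entire_const].
  - intros z K; apply (Hw z); replace (f z) with (f z - w + w) by ring; rewrite K; ring.
  - assert (H2 := C2_neq_0).
    exists (fun u => u * u + w), (fun z : C => Cexp (/ 2 * h z)); repeat split.
    + eapply entire_intro; intros z; apply (Cder_plus (fun u => u * u)); [|apply Cder_const].
      apply Cder_mult; apply Cder_id.
    + apply (entire_comp Cexp (fun z => / 2 * h z)); [apply entire_Cexp|].
      eapply entire_intro; intros z; now apply Cder_scal, entire_der.
    + intros [al [be [_ E]]].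
      (* The second difference at -1, 0, 1 is 2 for u^2 + w and 0 for an affine map. *)
      assert (E0 := E 0); assert (E1 := E 1); assert (E2 := E (- (1))).
      assert (K : RtoC 2 = 0); [|now apply H2].
      transitivity ((1 * 1 + w) + (- (1) * - (1) + w) - (0 * 0 + w) - (0 * 0 + w)); [ring|].
      rewrite E0, E1, E2; ring.
    (* An affine map has the zero -be/al; an exponential has none. *)
    + intros [al [be [Ha E]]]; apply (Cexp_neq_0 (/ 2 * h (- be / al))).
      rewrite E; field; auto.
    + intros z; rewrite <- Cexp_plus; replace (/ 2 * h z + / 2 * h z) with (h z) by (field; auto).
      rewrite <- Eh; ring.
Qed.

(** * Factorizations of primitives of e^p *)

Lemma elh_primitive_Cexp f u : entire u -> Cexp (u 0) = 1 ->
  (forall z, Cder f z (Cexp (u z))) -> elh f.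
Proof.
  intros Hu H0 Hf; repeat split.
  - now apply (entire_intro f (fun z => Cexp (u z))).
  - intros z; rewrite (C_derive_Cder _ _ _ (Hf z)); apply Cexp_neq_0.
  - now rewrite (C_derive_Cder _ _ _ (Hf 0)).
Qed.

Lemma factor_derivatives f F G u : entire F -> entire G ->
  (forall z, Cder f z (Cexp (u z))) -> (forall z, f z = F (G z)) ->
  forall z, C_derive F (G z) * C_derive G z = Cexp (u z).
Proof.
  intros HF HG Hf E z; apply (Cder_unique f z); [|apply Hf].
  apply (Cder_ext (fun z => F (G z))); [auto|].
  now apply Cder_comp; apply entire_der.
Qed.

Lemma factor_derivatives_neq_0 f F G u : entire F -> entire G ->
  (forall z, Cder f z (Cexp (u z))) -> (forall z, f z = F (G z)) ->
  forall z, C_derive F (G z) <> 0 /\ C_derive G z <> 0.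
Proof.
  intros HF HG Hf E z; assert (D := factor_derivatives f F G u HF HG Hf E z).
  assert (N := Cexp_neq_0 (u z)).
  split; intros K; apply N; rewrite <- D, K; ring.
Qed.

(* The inner factor is w0 + e^h with h of polynomial growth and h' zero-free, so
   h is affine and f is periodic; then e^p is periodic, which forces deg p = 1. *)
Lemma surjective_right_factor f F G p : Cpoly_nonconstant p ->
  (forall z, Cder f z (Cexp (Cpoly_eval p z))) -> f 0 = 0 ->
  (forall w, exists z, f z = w) ->
  entire F -> entire G -> exp_growth G -> (forall z, f z = F (G z)) ->
  forall w, exists z, G z = w.
Proof.
  intros Hp Hf F0 Hs HF HG Hgr E w0; apply NNPP; intros N.
  assert (HN := factor_derivatives_neq_0 f F G _ HF HG Hf E).
  destruct (entire_log (fun z => G z - w0)) as [h [Hh Eh]].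
  - apply entire_minus; [auto|apply entire_const].
  - intros z K; apply N; exists z; replace (G z) with (G z - w0 + w0) by ring; rewrite K; ring.
  - assert (Ph : poly_growth h).
    { apply poly_growth_log; auto; apply (exp_growth_ext (fun z => G z - w0)); auto.
      now apply exp_growth_minus_const. }
    assert (Nh : forall z, C_derive h z <> 0).
    { intros z K; apply (HN z), C_derive_Cder.
      apply (Cder_ext (fun z => w0 + Cexp (h z))); [intros x; rewrite <- Eh; ring|].
      eapply Cder_eq.
      - apply (Cder_plus (fun _ => w0)); [apply Cder_const|].
        apply (Cder_comp Cexp); [now apply entire_der|apply Cder_Cexp].
      - rewrite K; ring. }
    destruct (affine_of_poly_growth h Hh Nh Ph) as [al [be [Hal Eal]]].
    assert (NC : Ci * RtoC (2 * PI) <> 0).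
    { assert (Pp := PI_RGT_0); apply Cmult_neq_0; [apply Cmod_gt_0; rewrite Cmod_Ci; lra|].
      intros K; apply RtoC_inj in K; lra. }
    (* al * tau = 2 pi i, so tau is a period of G = w0 + e^h. *)
    set (tau := Ci * RtoC (2 * PI) / al).
    assert (Ht : tau <> 0).
    { intros K; apply NC; replace (Ci * RtoC (2 * PI)) with (tau * al)
        by (unfold tau; field; auto); rewrite K; ring. }
    assert (Per : forall z, f (z + tau) = f z).
    { intros z; rewrite !E; f_equal.
      assert (K : G (z + tau) - w0 = G z - w0).
      { rewrite !Eh, !Eal, <- (Cexp_2PI (al * z + be)); f_equal; unfold tau; field; auto. }
      replace (G (z + tau)) with (G (z + tau) - w0 + w0) by ring; rewrite K; ring. }
    set (P := Cpoly_eval p) in *.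
    assert (Pent : entire P) by apply entire_Cpoly_eval.
    assert (PerE : forall z, Cexp (P (z + tau)) = Cexp (P z)).
    { intros z; apply (Cder_unique f z); [|apply Hf].
      apply (Cder_ext (fun z => f (z + tau))); [auto|].
      eapply Cder_eq; [apply (Cder_comp f (fun z => z + tau)); [|apply Hf]|].
      - apply Cder_plus; [apply Cder_id|apply Cder_const].
      - ring. }
    (* The increment P(z + tau) - P(z) has exponential 1, hence is constant. *)
    assert (Lin : forall z, P z = P 0 + (P (0 + tau) - P 0) / tau * z).
    { apply Cpoly_translation_linear; auto; intros z; fold P.
      assert (K : P (z + tau) - P z = P (0 + tau) - P 0).
      { apply (Cexp_const_inv (fun z => P (z + tau) - P z) 1).
        - apply entire_minus; auto; apply (entire_comp P (fun z => z + tau)); auto.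
          apply (entire_intro _ (fun _ => 1 + 0)); intros x.
          apply Cder_plus; [apply Cder_id|apply Cder_const].
        - intros x; unfold Cminus; rewrite Cexp_plus, Cexp_opp, PerE.
          apply Cinv_r, Cexp_neq_0. }
      replace (P (z + tau)) with (P (z + tau) - P z + P z) by ring; rewrite K; ring. }
    set (m := (P (0 + tau) - P 0) / tau) in *.
    assert (Hm : m <> 0).
    { intros K; destruct (Cpoly_nonconstant_spec p Hp) as [z Hz]; apply Hz; fold P.
      rewrite Lin, K; ring. }
    (* f - e^P / m is constant, equal to -e^{P(0)} / m, so attaining this value would force e^P to
       vanish. *)
    destruct (Hs (- Cexp (P 0) / m)) as [z Hz].
    apply (Cexp_neq_0 (P z)).
    assert (K : f z - / m * Cexp (P z) = f 0 - / m * Cexp (P 0)).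
    { apply (zero_derivative_const (fun _ => True) (fun z => f z - / m * Cexp (P z))); auto.
      - intros a b t _ _ _; exact I.
      - intros x _; eapply Cder_eq.
        + apply Cder_minus; [apply Hf|]; apply Cder_scal.
          apply (Cder_ext (fun z => Cexp (P 0 + m * z))); [intros; now rewrite <- Lin|].
          apply (Cder_comp Cexp (fun z => P 0 + m * z)); [|apply Cder_Cexp].
          apply (Cder_plus (fun _ => P 0)); [apply Cder_const|apply Cder_scal, Cder_id].
        + rewrite <- Lin; field; auto. }
    rewrite Hz, F0 in K.
    transitivity (- m * ((- Cexp (P 0) / m - / m * Cexp (P z)) - (0 - / m * Cexp (P 0))));
      [field; auto|rewrite K; ring].
Qed.

Lemma surjective_not_composite f p : Cpoly_nonconstant p ->
  (forall z, Cder f z (Cexp (Cpoly_eval p z))) -> f 0 = 0 ->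
  (forall w, exists z, f z = w) -> ~ composite f.
Proof.
  intros Hp Hf F0 Hs [_ [F [G [HF [HG [NF [NG E]]]]]]].
  assert (HD := factor_derivatives f F G _ HF HG Hf E).
  assert (HN := factor_derivatives_neq_0 f F G _ HF HG Hf E).
  set (P := Cpoly_eval p) in *.
  assert (Pent : entire P) by apply entire_Cpoly_eval.
  assert (GP : poly_growth P) by apply poly_growth_Cpoly_eval.
  assert (Gf : exp_growth f).
  { apply (exp_growth_primitive f (fun z => Cexp (P z))); auto; now apply exp_growth_Cexp. }
  assert (GG : exp_growth G).
  { apply (exp_growth_right_factor F G (G 0)); auto; [apply HN|].
    now apply (exp_growth_ext f). }
  assert (SG := surjective_right_factor f F G p Hp Hf F0 Hs HF HG GG E).
  destruct (entire_log (C_derive F)) as [h [Hh Eh]].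
  { now apply entire_C_derive. }
  { intros u; destruct (SG u) as [z <-]; apply HN. }
  destruct (entire_log (C_derive G)) as [q [Hq Eq]].
  { now apply entire_C_derive. }
  { apply HN. }
  assert (Gq : poly_growth q).
  { apply poly_growth_log; auto; apply (exp_growth_ext (C_derive G)); auto.
    now apply exp_growth_derive. }
  (* The chain rule F'(G) G' = e^P says that h(G) + q - P has exponential 1. *)
  assert (Eqn : forall z, h (G z) + q z - P z = h (G 0) + q 0 - P 0).
  { intros z; apply (Cexp_const_inv (fun z => h (G z) + q z - P z) 1).
    - apply entire_minus; auto; apply entire_plus; auto; now apply entire_comp.
    - intros x; unfold Cminus; rewrite !Cexp_plus, Cexp_opp, <- Eh, <- Eq, HD.
      apply Cinv_r, Cexp_neq_0. }
  assert (GhG : poly_growth (fun z => h (G z))).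
  { apply (poly_growth_ext (fun z => (h (G 0) + q 0 - P 0) + (P z + - (1) * q z))).
    - intros z; rewrite <- (Eqn z); ring.
    - apply (poly_growth_plus (fun _ => h (G 0) + q 0 - P 0)); [apply poly_growth_const|].
      apply poly_growth_plus; [auto|].
      apply (poly_growth_mult (fun _ => - (1))); [apply poly_growth_const|auto]. }
  (* A point with h'(a) nonzero is what the growth theorem asks of its outer function, here h in
     place of F. *)
  destruct (classic (exists a, C_derive h a <> 0)) as [[a Ha]|Nh].
  - apply NG, affine_of_poly_growth; auto; [apply HN|].
    now apply (poly_growth_right_factor h G a).
  - apply NF, (affine_of_const_derivative F (Cexp (h 0))); auto; [apply Cexp_neq_0|].
    intros z; rewrite Eh; f_equal; apply derive_0_const; auto.
    intros x; apply NNPP; intros K; apply Nh; eauto.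
Qed.

Lemma primitive_not_AutC f p : Cpoly_nonconstant p ->
  (forall z, Cder f z (Cexp (Cpoly_eval p z))) -> ~ AutC f.
Proof.
  intros Hp Hf [a Ha]; destruct (Cpoly_nonconstant_spec p Hp) as [z Hz]; apply Hz.
  apply (Cexp_const_inv (Cpoly_eval p) (1 + 0)); [apply entire_Cpoly_eval|].
  intros x; apply (Cder_unique f x); [apply Hf|].
  apply (Cder_ext (fun z => z + a)); [auto|].
  apply Cder_plus; [apply Cder_id|apply Cder_const].
Qed.

Theorem theorem7p13 :
  forall (p : list C),
    Cpoly_nonconstant p ->
    Cexp (Cpoly_eval p 0) = 1 ->
    let f : C -> C := fun z => C_int (fun t => Cexp (Cpoly_eval p t)) 0 z in
    (elh f /\ ~ AutC f) /\
    (elh_prime f <-> (forall w : C, exists z : C, f z = w)).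
Proof.
  intros p Hp H1 f.
  assert (Hf : forall z, Cder f z (Cexp (Cpoly_eval p z))).
  (* [C_int] from 0 is a primitive on every disc about 0; one reaching past z suffices. *)
  { intros z; apply (disc_primitive 0 (Cmod z + 1) (fun t => Cexp (Cpoly_eval p t))).
    - intros w _; apply entire_Cder, entire_comp; [apply entire_Cexp|apply entire_Cpoly_eval].
    - unfold odisc; replace (z - 0) with z by ring; lra. }
  assert (Ef : elh f) by (apply (elh_primitive_Cexp f (Cpoly_eval p)); auto; apply entire_Cpoly_eval).
  assert (Nf : ~ AutC f) by now apply (primitive_not_AutC f p).
  split; [now split|split].
  - intros [_ [_ Nc]] w; apply NNPP; intros N; apply Nc, (omitting_composite f w); auto.
    intros z Hz; apply N; now exists z.
  - intros Hs; repeat split; try apply Ef; auto.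
    apply (surjective_not_composite f p); auto; apply C_int_refl.
Qed.
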